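(* Let $0<\varepsilon\le 1$ be a constant, $s=s(n)$ an integer with $|s|\le(1-\varepsilon)n$, $z\in\mathbb C$ fixed, and $F_n$ a deterministic $n\times n$ matrix all of whose rows equal a given vector in $\{-1,1\}^n$. Let $\mathbf f_1,\dots,\mathbf f_n$ be the rows of $F_n+z\sqrt n I_n$. Let $\mathbf x_1,\dots,\mathbf x_n$ be independent random vectors, each uniform on the set $\mathcal S$ of vectors in $\{-1,1\}^n$ with coordinate sum $s-1$ or $s+1$, and let $\mathbf x_1',\dots,\mathbf x_n'$ be independent random vectors (independent of the $\mathbf x_i$) whose coordinates are i.i.d. copies of $x$ with $\mathbb P(x=-1)=\frac12-\frac{s}{2n}$, $\mathbb P(x=1)=\frac12+\frac{s}{2n}$. Let $V_{i-1}$ be the span of $\mathbf x_1+\mathbf f_1,\dots,\mathbf x_{i-1}+\mathbf f_{i-1}$ and $V_{i-1}'$ the span of $\mathbf x_1'+\mathbf f_1,\dots,\mathbf x_{i-1}'+\mathbf f_{i-1}$ (with $V_0=V_0'=\{0\}$). Let $m=n-\log^8 n$ and $$S_1=\prod_{i\le m}\mathrm{dist}(\mathbf x_i+\mathbf f_i,V_{i-1}),\qquad S_1'=\prod_{i\le m}\mathrm{dist}(\mathbf x_i'+\mathbf f_i,V_{i-1}').$$ Then with probability $1-\exp(-\log^{2-o(1)}n)$ we have $\frac1n|\log S_1-\log S_1'|=O(\log^{-2}n)$. *)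

(* Defs.v *)
From Stdlib Require Import Rdefinitions Rfunctions Rpower.
From HB Require Import structures.
From mathcomp Require Import all_boot all_order all_algebra.
From mathcomp Require Import complex.
From mathcomp Require Import boolp classical_sets reals.
From mathcomp Require Import Rstruct.
Set Implicit Arguments. Unset Strict Implicit. Unset Printing Implicit Defensive.
Import Order.TTheory GRing.Theory Num.Theory.
Local Open Scope ring_scope.

Notation RR := Rdefinitions.R.

(* A vector in {-1,1}^n is coded by b : {ffun 'I_n -> bool}, true |-> 1, false |-> -1. *)
Definition sgn (b : bool) : RR := if b then 1 else -1.

Definition coordsum n (x : {ffun 'I_n -> bool}) : RR := \sum_(j < n) sgn (x j).

Definition Sset n (s : int) : {set {ffun 'I_n -> bool}} :=
  [set x | (coordsum x == s%:~R - 1) || (coordsum x == s%:~R + 1)].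

Definition wS n (s : int) (x : {ffun 'I_n -> bool}) : RR :=
  if x \in Sset n s then (#|Sset n s|%:R)^-1 else 0.

Definition pplus n (s : int) : RR := 2^-1 + s%:~R / (2 * n%:R).
Definition wB n (s : int) (x : {ffun 'I_n -> bool}) : RR :=
  \prod_(j < n) (if x j then pplus n s else 1 - pplus n s).

Notation rowsT n := {ffun 'I_n -> {ffun 'I_n -> bool}}.

Definition Prob n (s : int) (E : rowsT n -> rowsT n -> bool) : RR :=
  \sum_(X : rowsT n) \sum_(X' : rowsT n)
     ((\prod_(i < n) wS s (X i)) * (\prod_(i < n) wB s (X' i)) * (E X X')%:R).

(* Row i of x + f, where f_i is row i of F_n + z sqrt(n) I_n and every row of F_n is v. *)
Definition rowC n (z : RR[i]) (v : {ffun 'I_n -> bool}) (X : rowsT n) (i : 'I_n)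
  : 'I_n -> RR[i] :=
  fun j => ((sgn (X i j) + sgn (v j))%:C)%C
           + (if j == i then z * ((Num.sqrt (n%:R : RR))%:C)%C else 0).

Definition cnorm n (w : 'I_n -> RR[i]) : RR := Num.sqrt (\sum_(j < n) ((complex.Re (w j)) ^+ 2 + (complex.Im (w j)) ^+ 2)).

Definition dist_span n (u : 'I_n -> RR[i]) (w : 'I_n -> 'I_n -> RR[i]) (i : 'I_n) : RR :=
  inf [set d : RR | exists c : 'I_n -> RR[i],
        d = cnorm (fun k => u k - \sum_(j < n | (j < i)%N) c j * w j k)].

(* S_1 = prod_{i <= m} dist(x_i + f_i, V_{i-1}) with m = n - log^8 n (natural log),
   i ranging over 1..n, i <= m; here i is 0-based so the index is i+1. *)
Definition Sprod n (z : RR[i]) (v : {ffun 'I_n -> bool}) (X : rowsT n) : RR :=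
  \prod_(i < n | (i.+1)%:R <= (n%:R : RR) - (ln (n%:R)) ^+ 8)
     dist_span (rowC z v X i) (rowC z v X) i.

Definition good_event n (z : RR[i]) (v : {ffun 'I_n -> bool}) (C : RR)
  (X X' : rowsT n) : bool :=
  [&& 0 < Sprod z v X, 0 < Sprod z v X' &
      `|ln (Sprod z v X) - ln (Sprod z v X')| / n%:R <= C / (ln (n%:R)) ^+ 2].

(* Main.v *)
Require Import Defs.
From Stdlib Require Import Rdefinitions Rfunctions Rpower.
From Stdlib Require Exp_prop.
From HB Require Import structures.
From mathcomp Require Import all_boot all_order all_algebra.
From mathcomp Require Import complex.
From mathcomp Require Import boolp classical_sets reals.
From mathcomp Require Import Rstruct.
From mathcomp Require Import perm ring lra zify finset.
Set Implicit Arguments. Unset Strict Implicit. Unset Printing Implicit Defensive.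
Import Order.TTheory GRing.Theory Num.Theory.
Local Open Scope ring_scope.

(* Regularize: for a = sqrt n log^4 n let G(U) = ln det (a I + sum_(i <= m) u_i^* u_i), where
   u_1, ..., u_n are the rows of U.  The matrix determinant lemma isolates the contribution
   ln (1 + |u_i|_A^2) of a single row, with |u|_A^2 = u A^-1 u^* and A independent of u_i.
   It is O(log n), so McDiarmid's inequality concentrates G around its mean under both laws.
   It changes by at most t + (1 + 1/t) |u - u'|^2 / a, for any t > 0, when u_i moves from u to
   u', and the slice law and the Bernoulli law are coupled within mean Hamming distance
   O(sqrt n); replacing the rows one by one, with t = log^-2 n, shows that the two means of G
   differ by O(n / log^2 n).

   It remains to compare G - (n - m) log a with 2 log S_1.  Revealing the coordinates of x one
   at a time, always the one along which the current projection has its largest diagonal entry,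
   shows that dist(x + f, W)^2 >= c k^2 / n outside an event of probability exp(-c k), where k
   is the codimension of W; the slice law is dominated by O(n) times the Bernoulli law, so this holds for both laws.  For the
   first m' = n - n / log^3 n rows, the regularized squared distance of row i exceeds D_i (the
   squared distance to the span of the previous rows) by a factor at most
   1 + a |g_i|^2 / D_i, where the Gram-Schmidt vector is g_i U, and
   sum_i |g_i|^2 / D_i <= sum_j 1 / dist(u_j, span of the other rows)^2.  The remaining rows are
   too few to matter and only need polynomial bounds. *)

(** * Hermitian forms and orthogonal projections *)

Section HermitianForms.
Variable R : rcfType.
Local Notation C := R[i].
Local Notation Re := complex.Re.
Local Notation Im := complex.Im.

Definition adj m n (A : 'M[C]_(m, n)) : 'M[C]_(n, m) := map_mx conjc A^T.

Lemma adjK m n (A : 'M[C]_(m, n)) : adj (adj A) = A.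
Proof. by apply/matrixP=> i j; rewrite !mxE conjcK. Qed.

Lemma adj11 (x : 'M[C]_1) : adj x 0 0 = ((x 0 0)^*)%C.
Proof. by rewrite !mxE. Qed.

Lemma adjM m n p (A : 'M[C]_(m, n)) (B : 'M[C]_(n, p)) :
  adj (A *m B) = adj B *m adj A.
Proof. by rewrite /adj trmx_mul map_mxM. Qed.

Lemma adjD m n (A B : 'M[C]_(m, n)) : adj (A + B) = adj A + adj B.
Proof. by rewrite /adj raddfD /= map_mxD. Qed.

Lemma adjN m n (A : 'M[C]_(m, n)) : adj (- A) = - adj A.
Proof. by rewrite /adj raddfN /= map_mxN. Qed.

Lemma adjB m n (A B : 'M[C]_(m, n)) : adj (A - B) = adj A - adj B.
Proof. by rewrite adjD adjN. Qed.

Lemma adj0 m n : adj (0 : 'M[C]_(m, n)) = 0.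
Proof. by rewrite /adj trmx0 map_mx0. Qed.

Lemma adjZ m n (c : C) (A : 'M[C]_(m, n)) : adj (c *: A) = (c^*)%C *: adj A.
Proof. by rewrite /adj linearZ /= map_mxZ. Qed.

Lemma adj_scalar n (c : C) : adj (c%:M : 'M[C]_n) = (c^*)%C%:M.
Proof. by rewrite /adj tr_scalar_mx map_scalar_mx. Qed.

Lemma adj_sum m n (I : finType) (P : pred I) (F : I -> 'M[C]_(m, n)) :
  adj (\sum_(i | P i) F i) = \sum_(i | P i) adj (F i).
Proof. by apply: (big_morph (@adj m n) (@adjD m n) (adj0 m n)). Qed.

Lemma ReD (x y : C) : Re (x + y) = Re x + Re y.
Proof. by case: x y => [a b] [c d]. Qed.

Lemma ReN (x : C) : Re (- x) = - Re x.
Proof. by case: x. Qed.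

Lemma Re_sum (I : finType) (P : pred I) (F : I -> C) :
  Re (\sum_(i | P i) F i) = \sum_(i | P i) Re (F i).
Proof. by elim/big_rec2: _ => // i x y _ IH; rewrite ReD IH. Qed.

Lemma Re_nat k : Re (k%:R : C) = k%:R.
Proof. by elim: k => // k IH; rewrite !mulrS ReD IH. Qed.

Lemma Re_conj (x : C) : Re (x^*)%C = Re x.
Proof. by case: x. Qed.

Lemma ReZ (a : R) (x : C) : Re (a%:C%C * x) = a * Re x.
Proof. by case: x => b c /=; ring. Qed.

Definition sqn (c : C) : R := Re c ^+ 2 + Im c ^+ 2.

Lemma sqn_ge0 c : 0 <= sqn c.
Proof. by rewrite addr_ge0 ?sqr_ge0. Qed.

Lemma sqnE c : c * (c^*)%C = (sqn c)%:C%C.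
Proof.
case: c => a b; rewrite /sqn /=; apply/eqP; rewrite eq_complex /=.
by apply/andP; split; apply/eqP; ring.
Qed.

Lemma sqn0 : sqn 0 = 0.
Proof. by rewrite /sqn /=; ring. Qed.

Lemma sqn1 : sqn 1 = 1.
Proof. by rewrite /sqn /=; ring. Qed.

Lemma sqnN c : sqn (- c) = sqn c.
Proof. by case: c => a b; rewrite /sqn /=; ring. Qed.

Lemma sqn_conj c : sqn (c^*)%C = sqn c.
Proof. by case: c => a b; rewrite /sqn /=; ring. Qed.

Lemma sqnM c d : sqn (c * d) = sqn c * sqn d.
Proof. by case: c d => a b [e f]; rewrite /sqn /=; ring. Qed.

Lemma sqn_real (a : R) : sqn a%:C%C = a ^+ 2.
Proof. by rewrite /sqn /=; ring. Qed.

Lemma sqnD_le c d : sqn (c + d) <= 2 * sqn c + 2 * sqn d.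
Proof.
case: c d => a b [e f]; rewrite /sqn /= -subr_ge0.
have -> : 2 * (a ^+ 2 + b ^+ 2) + 2 * (e ^+ 2 + f ^+ 2) - ((a + e) ^+ 2 + (b + f) ^+ 2)
  = (a - e) ^+ 2 + (b - f) ^+ 2 by ring.
by rewrite addr_ge0 ?sqr_ge0.
Qed.

(* The real part of the Hermitian product, so that all estimates take place in R. *)
Definition ip n (u v : 'rV[C]_n) : R := Re ((u *m adj v) 0 0).
Definition nrm2 n (u : 'rV[C]_n) : R := ip u u.

Lemma ipC n (u v : 'rV[C]_n) : ip u v = ip v u.
Proof. by rewrite /ip -[v *m adj u]adjK adjM adjK !mxE Re_conj. Qed.

Lemma ipDl n (u v w : 'rV[C]_n) : ip (u + v) w = ip u w + ip v w.
Proof. by rewrite /ip mulmxDl mxE ReD. Qed.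

Lemma ipDr n (u v w : 'rV[C]_n) : ip w (u + v) = ip w u + ip w v.
Proof. by rewrite ![ip w _]ipC ipDl. Qed.

Lemma ipNl n (u w : 'rV[C]_n) : ip (- u) w = - ip u w.
Proof. by rewrite /ip mulNmx mxE ReN. Qed.

Lemma ipNr n (u w : 'rV[C]_n) : ip w (- u) = - ip w u.
Proof. by rewrite ![ip w _]ipC ipNl. Qed.

Lemma ipZl n (a : R) (u w : 'rV[C]_n) : ip (a%:C%C *: u) w = a * ip u w.
Proof. by rewrite /ip -scalemxAl mxE ReZ. Qed.

Lemma ipZr n (a : R) (u w : 'rV[C]_n) : ip w (a%:C%C *: u) = a * ip w u.
Proof. by rewrite ![ip w _]ipC ipZl. Qed.

Lemma ip0l n (w : 'rV[C]_n) : ip 0 w = 0.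
Proof. by rewrite /ip mul0mx mxE. Qed.

Lemma ip_suml n (I : finType) (P : pred I) (F : I -> 'rV[C]_n) w :
  ip (\sum_(i | P i) F i) w = \sum_(i | P i) ip (F i) w.
Proof.
by apply: (big_morph (fun u => ip u w) (fun u v => ipDl u v w) (ip0l w)).
Qed.

Lemma ip_mull m n (u : 'rV[C]_m) (A : 'M[C]_(m, n)) (v : 'rV[C]_n) :
  ip (u *m A) v = ip u (v *m adj A).
Proof. by rewrite /ip adjM adjK mulmxA. Qed.

Lemma nrm2E n (u : 'rV[C]_n) : nrm2 u = \sum_j sqn (u 0 j).
Proof.
rewrite /nrm2 /ip mxE Re_sum; apply: eq_bigr => j _.
by rewrite !mxE sqnE.
Qed.

Lemma nrm2_ge0 n (u : 'rV[C]_n) : 0 <= nrm2 u.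
Proof. by rewrite nrm2E sumr_ge0 // => j _; apply: sqn_ge0. Qed.

Lemma sqn_eq0 c : sqn c = 0 -> c = 0.
Proof.
case: c => a b; rewrite /sqn /= => /eqP.
by rewrite paddr_eq0 ?sqr_ge0 // !sqrf_eq0 => /andP[/eqP-> /eqP->].
Qed.

Lemma nrm2_eq0 n (u : 'rV[C]_n) : nrm2 u = 0 -> u = 0.
Proof.
rewrite nrm2E => /eqP; rewrite psumr_eq0 => [/allP h|j _]; last exact: sqn_ge0.
apply/rowP=> j; rewrite mxE; apply: sqn_eq0; apply/eqP.
by have := h j (mem_index_enum _).
Qed.

Lemma nrm20 n : nrm2 (0 : 'rV[C]_n) = 0.
Proof. exact: ip0l. Qed.

Lemma nrm2D n (u v : 'rV[C]_n) : nrm2 (u + v) = nrm2 u + nrm2 v + 2 * ip u v.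
Proof. rewrite /nrm2 ipDl !ipDr (ipC v u); ring. Qed.

Lemma nrm2N n (u : 'rV[C]_n) : nrm2 (- u) = nrm2 u.
Proof. by rewrite /nrm2 ipNl ipNr opprK. Qed.

Lemma nrm2Z n c (u : 'rV[C]_n) : nrm2 (c *: u) = sqn c * nrm2 u.
Proof. by rewrite !nrm2E mulr_sumr; apply: eq_bigr => j _; rewrite mxE sqnM. Qed.

Lemma mulmx_adj_self n (u : 'rV[C]_n) : u *m adj u = ((nrm2 u)%:C%C)%:M.
Proof.
apply/matrixP=> i j; rewrite !ord1 nrm2E mxE !mxE eqxx mulr1n rmorph_sum /=.
by apply: eq_bigr => k _; rewrite !mxE sqnE.
Qed.

Definition orthoproj n (P : 'M[C]_n) := adj P = P /\ P *m P = P.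

Lemma orthoproj1 n : orthoproj (1%:M : 'M[C]_n).
Proof. by split; rewrite ?mul1mx // adj_scalar rmorph1. Qed.

Lemma nrm2_proj n (P : 'M[C]_n) y : orthoproj P -> nrm2 (y *m P) = ip (y *m P) y.
Proof.
case=> hP PP; have -> : ip (y *m P) y = ip (y *m P *m P) y by rewrite -mulmxA PP.
by rewrite [RHS]ip_mull hP.
Qed.

Lemma nrm2_proj_le n (P : 'M[C]_n) y : orthoproj P -> nrm2 (y *m P) <= nrm2 y.
Proof.
move=> hP; have := nrm2_ge0 (y - y *m P).
rewrite nrm2D nrm2N ipNr ipC -(nrm2_proj y hP); lra.
Qed.

(** For [h] in the range of the projection [P], this projects onto the part of that range orthogonal
    to [h]. *)
Definition deflate n (P : 'M[C]_n) (h : 'rV[C]_n) : 'M[C]_n :=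
  P - ((nrm2 h)^-1)%:C%C *: (adj h *m h).

Section Deflation.
Variables (n : nat) (P : 'M[C]_n) (h : 'rV[C]_n).
Hypotheses (oP : orthoproj P) (hPh : h *m P = h) (h0 : h != 0).
Local Notation N := (nrm2 h).
Local Notation E := ((N^-1)%:C%C *: (adj h *m h)).

Let NV : (N^-1)%:C%C * N%:C%C = 1 :> C.
Proof.
rewrite -rmorphM /= mulVf //.
by apply: contra h0 => /eqP/nrm2_eq0/eqP.
Qed.

Let Ph : P *m adj h = adj h.
Proof. by case: oP => aP _; move: (congr1 (@adj _ _) hPh); rewrite adjM aP. Qed.

Lemma deflate_orthoproj : orthoproj (deflate P h).
Proof.
case: (oP) => aP PP; split.
  by rewrite /deflate adjB aP adjZ adjM adjK conjc_real.
have hE : h *m E = h.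
  by rewrite -scalemxAr mulmxA mulmx_adj_self mul_scalar_mx scalerA NV scale1r.
have PE : P *m E = E by rewrite -scalemxAr mulmxA Ph.
have EP : E *m P = E by rewrite -scalemxAl -mulmxA hPh.
have EE : E *m E = E by rewrite -{1}scalemxAl -mulmxA hE.
by rewrite /deflate mulmxBl !mulmxBr PP PE EP EE subrr subr0.
Qed.

Lemma deflate_kill u : u *m P = h -> u *m deflate P h = 0.
Proof.
move=> uP; have uh : u *m adj h = N%:C%C%:M by rewrite -Ph mulmxA uP mulmx_adj_self.
rewrite mulmxBr -scalemxAr mulmxA uh mul_scalar_mx scalerA NV scale1r uP.
exact: subrr.
Qed.

Lemma deflate_killed (v : 'rV_n) : v *m P = 0 -> v *m deflate P h = 0.
Proof.
move=> vP; rewrite mulmxBr vP -scalemxAr -Ph !mulmxA vP !mul0mx scaler0.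
by rewrite subr0.
Qed.

Lemma deflate_tr : Re (\tr (deflate P h)) = Re (\tr P) - 1.
Proof.
rewrite /deflate linearB /= linearZ /= mxtrace_mulC mulmx_adj_self mxtrace_scalar.
by rewrite mulr1n NV ReD ReN.
Qed.

(** Pythagoras: the second term is the squared length of the component of [y] along [h]. *)
Lemma deflate_nrm2 y :
  nrm2 (y *m P) = nrm2 (y *m deflate P h) + sqn ((y *m adj h) 0 0) / N.
Proof.
rewrite (nrm2_proj _ deflate_orthoproj) (nrm2_proj _ oP).
rewrite mulmxBr ipDl ipNl -scalemxAr ipZl mulmxA [ip (_ *m h) y]ip_mull.
by rewrite -/(nrm2 (y *m adj h)) (nrm2E (y *m adj h)) big_ord1; ring.
Qed.

End Deflation.

(* P projects onto the orthogonal complement of the rows of U selected by S, and M records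
   coefficients: y - y P = (y M) U. *)
Definition span_proj n (U : 'M[C]_n) (S : {set 'I_n}) (P M : 'M[C]_n) :=
  [/\ orthoproj P, (forall j, j \in S -> row j U *m P = 0),
      n%:R - #|S|%:R <= Re (\tr P), 1%:M - P = M *m U
    & forall i j, j \notin S -> M i j = 0].


Lemma span_proj_step n (U : 'M[C]_n) (S : {set 'I_n}) i : i \notin S ->
  (exists P M, span_proj U S P M) -> exists P M, span_proj U (i |: S) P M.
Proof.
move=> iS [P [M [oP kP tP eP mP]]]; have [aP PP] := oP.
set u := row i U; set h := u *m P.
have hPh : h *m P = h by rewrite /h -mulmxA PP.
have cS : #|i |: S|%:R = 1 + #|S|%:R :> R by rewrite cardsU1 iS natrD.
(* If row [i] already lies in the span, [P] is kept and only the cardinal grows; hence the trace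
   condition in [span_proj] is an inequality. *)
have [h0|h0] := eqVneq h 0.
  exists P, M; split=> //.
  - by move=> j; rewrite in_setU1 => /orP[/eqP->|/kP].
  - by rewrite cS; lra.
  - by move=> k j; rewrite in_setU1 negb_or => /andP[_ /mP].
(* The new direction is [h = (d - u M) U], so the rank-one term removed by the deflation has these
   coefficients and is added to [M]. *)
pose d := delta_mx 0 i : 'rV[C]_n.
exists (deflate P h), (M + ((nrm2 h)^-1)%:C%C *: (adj h *m (d - u *m M))); split.
- exact: deflate_orthoproj.
- move=> j; rewrite in_setU1 => /orP[/eqP->|jS]; first exact: deflate_kill.
  exact/deflate_killed/kP.
- by rewrite cS deflate_tr //; lra.
- have hE : h = (d - u *m M) *m U.
    by rewrite mulmxBl -mulmxA -eP mulmxBr mulmx1 -rowE opprB addrC subrK.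
  rewrite mulmxDl -eP -scalemxAl -[adj h *m _ *m U]mulmxA -hE /deflate.
  by rewrite opprB addrCA addrC.
- move=> k j; rewrite in_setU1 negb_or => /andP[ji jS].
  rewrite !mxE mP // big_ord1 add0r [X in _ * (_ * X)](_ : _ = 0) ?mulr0 //.
  rewrite !mxE (negbTE ji) andbF big1 ?subr0 // => l _.
  by rewrite mP // mulr0.
Qed.

Lemma exists_span_proj n (U : 'M[C]_n) S : exists P M, span_proj U S P M.
Proof.
have [k] := ubnP #|S|; elim: k S => // k IH S.
have [->|[i iS]] := set_0Vmem S.
  move=> _; exists 1%:M, 0; split.
  - exact: orthoproj1.
  - by move=> j; rewrite inE.
  - by rewrite mxtrace_scalar cards0 subr0 Re_nat.
  - by rewrite subrr mul0mx.
  - by move=> i j; rewrite mxE.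
rewrite (cardsD1 i) iS => cS; rewrite -(setD1K iS).
by apply: span_proj_step; [rewrite !inE eqxx | apply: IH; move: cS; lia].
Qed.

Section SpanProj.
Variables (n : nat) (U : 'M[C]_n) (S : {set 'I_n}) (P M : 'M[C]_n).
Hypothesis spP : span_proj U S P M.

Lemma span_proj_decomp (u : 'rV_n) : u *m P = u - (u *m M) *m U.
Proof. by case: spP => _ _ _ eP _; rewrite -mulmxA -eP mulmxBr mulmx1 subKr. Qed.

Lemma span_proj_supp (u : 'rV_n) j : j \notin S -> (u *m M) 0 j = 0.
Proof.
case: spP => _ _ _ _ mP jS; rewrite mxE big1 // => l _; by rewrite mP // mulr0.
Qed.

Lemma span_proj_comb0 (c : 'rV_n) :
  (forall j, j \notin S -> c 0 j = 0) -> c *m U *m P = 0.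
Proof.
case: spP => _ kP _ _ _ cS; rewrite (mulmx_sum_row c U) mulmx_suml big1 // => j _.
rewrite -scalemxAl; have [jS|jS] := boolP (j \in S); first by rewrite kP ?scaler0.
by rewrite cS ?scale0r.
Qed.

(** [P] kills [c U] and contracts. With [span_proj_decomp], [nrm2 (u *m P)] is thus the squared
    distance from [u] to the span. *)
Lemma span_proj_min (u c : 'rV_n) : (forall j, j \notin S -> c 0 j = 0) ->
  nrm2 (u *m P) <= nrm2 (u - c *m U).
Proof.
move=> cS; case: (spP) => oP _ _ _ _.
have := nrm2_proj_le (u - c *m U) oP.
by rewrite mulmxBl span_proj_comb0 // subr0.
Qed.

End SpanProj.

End HermitianForms.

(** * Regularized Gram matrices *)

Section Regularization.
Variable R : rcfType.
Local Notation C := R[i].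
Local Notation Re := complex.Re.

(** Both products in [e] equal the block matrix with rows (1, -x) and (r, 1); comparing their
    determinants gives the identity. *)
Lemma det_1D_rank1 (F : comUnitRingType) n (x : 'cV[F]_n) (r : 'rV[F]_n) :
  \det (1%:M + x *m r) = 1 + (r *m x) 0 0.
Proof.
have e : block_mx 1%:M 0 r 1%:M *m block_mx 1%:M (- x) 0 (1%:M + r *m x)
       = block_mx (1%:M + x *m r) (- x) 0 1%:M *m block_mx 1%:M 0 r 1%:M.
  rewrite !mulmx_block !mul1mx !mulmx1 !mul0mx !mulmx0 !addr0 !add0r.
  by rewrite mulmxN mulNmx addrK addrCA addNr addr0.
have /(congr1 determinant) := e.
rewrite !det_mulmx !det_lblock !det_ublock !det1 !mul1r !mulr1 => <-.
by rewrite det_mx11 [LHS]mxE [X in X + _]mxE eqxx.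
Qed.

Lemma det_add_rank1 (F : comUnitRingType) n (A : 'M[F]_n) (x : 'cV[F]_n) (r : 'rV[F]_n) :
  A \in unitmx -> \det (A + x *m r) = \det A * (1 + (r *m invmx A *m x) 0 0).
Proof.
move=> Au; have -> : A + x *m r = A *m (1%:M + (invmx A *m x) *m r).
  by rewrite mulmxDr mulmx1 !mulmxA mulmxV // mul1mx.
by rewrite det_mulmx det_1D_rank1 mulmxA.
Qed.

Lemma adj_invmx n (A : 'M[C]_n) : adj (invmx A) = invmx (adj A).
Proof. by rewrite /adj trmx_inv map_invmx. Qed.

Lemma Re_mul_le (c d : C) : 2 * Re (c * d) <= sqn c + sqn d.
Proof.
case: c d => a b [e f]; rewrite /sqn /= -subr_ge0.
have -> : a ^+ 2 + b ^+ 2 + (e ^+ 2 + f ^+ 2) - 2 * (a * e - b * f)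
  = (a - e) ^+ 2 + (b + f) ^+ 2 by ring.
by rewrite addr_ge0 ?sqr_ge0.
Qed.

Definition regmx n (a : R) (U : 'M[C]_n) (S : {set 'I_n}) : 'M[C]_n :=
  (a%:C%C)%:M + \sum_(j in S) adj (row j U) *m row j U.

Definition rq n (A : 'M[C]_n) (u : 'rV[C]_n) : R := ip (u *m invmx A) u.

(** The determinant is a positive real number by [regmx_det]; the real part only carries it from the
    complex numbers to [R]. *)
Definition detr n (a : R) (U : 'M[C]_n) S := Re (\det (regmx a U S)).

Variables (n : nat) (a : R).
Hypothesis a0 : 0 < a.
Implicit Types (U : 'M[C]_n) (S : {set 'I_n}) (u v w : 'rV[C]_n).

Lemma regmx_adj U S : adj (regmx a U S) = regmx a U S.
Proof.
rewrite /regmx adjD adj_scalar conjc_real adj_sum; congr (_ + _).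
by apply: eq_bigr => j _; rewrite adjM adjK.
Qed.

Lemma mul_regmx U S w :
  w *m regmx a U S
  = a%:C%C *: w + \sum_(j in S) (w *m adj (row j U)) 0 0 *: row j U.
Proof.
rewrite mulmxDr mul_mx_scalar mulmx_sumr; congr (_ + _).
by apply: eq_bigr => j _; rewrite mulmxA [w *m _ in LHS]mx11_scalar mul_scalar_mx.
Qed.

Lemma regmx_form U S w :
  ip (w *m regmx a U S) w = a * nrm2 w + \sum_(j in S) sqn ((w *m adj (row j U)) 0 0).
Proof.
rewrite mul_regmx ipDl ipZl ip_suml; congr (_ + _).
apply: eq_bigr => j _; rewrite /ip -scalemxAl mxE.
by rewrite -[row j U *m _]adjK adjM adjK !mxE sqnE.
Qed.

Lemma regmx_U1 U S i : i \notin S ->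
  regmx a U (i |: S) = regmx a U S + adj (row i U) *m row i U.
Proof. by move=> iS; rewrite /regmx big_setU1 //= addrCA addrC. Qed.

Lemma rq_complex U S u : regmx a U S \in unitmx ->
  (u *m invmx (regmx a U S) *m adj u) 0 0 = (rq (regmx a U S) u)%:C%C.
Proof.
move=> Au; rewrite /rq /ip; set x := (_ *m _); set z := x 0 0.
have : (z^*)%C = z.
  have <- : adj x 0 0 = (z^*)%C by rewrite adj11.
  by rewrite /z /x !adjM adjK adj_invmx regmx_adj mulmxA.
case: z => b c [] /eqP; rewrite eq_sym -addr_eq0 -mulr2n mulrn_eq0 /= => /eqP->.
by [].
Qed.

Section Rq.
Variables (U : 'M[C]_n) (S : {set 'I_n}).
Hypothesis Au : regmx a U S \in unitmx.
Local Notation A := (regmx a U S).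

Lemma rq_form u : rq A u =
  a * nrm2 (u *m invmx A) + \sum_(j in S) sqn ((u *m invmx A *m adj (row j U)) 0 0).
Proof. by rewrite -regmx_form mulmxKV // ipC. Qed.

Lemma rq_ge0 u : 0 <= rq A u.
Proof.
rewrite rq_form; apply: addr_ge0; first by rewrite mulr_ge0 ?nrm2_ge0 // ltW.
by apply: sumr_ge0 => j _; apply: sqn_ge0.
Qed.

(** With w = u A^-1, the form dominates a |w|^2; expand |u - a w|^2 >= 0. *)
Lemma rq_le u : a * rq A u <= nrm2 u.
Proof.
have h1 : a * nrm2 (u *m invmx A) <= rq A u.
  by rewrite rq_form lerDl sumr_ge0 // => j _; apply: sqn_ge0.
have := nrm2_ge0 (u - a%:C%C *: (u *m invmx A)).
rewrite nrm2D nrm2N ipNr nrm2Z sqn_real ipZr (ipC u) -/(rq A u) => h2.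
move: (ler_wpM2l (ltW a0) h1); nra.
Qed.

(** Write u = w A. The projection kills every rank-one term of [A], so u P = a w P, and a |w|^2 is
    at most the form. *)
Lemma rq_proj_le (P : 'M[C]_n) u : orthoproj P ->
  (forall j, j \in S -> row j U *m P = 0) -> nrm2 (u *m P) <= a * rq A u.
Proof.
move=> oP kP; set w := u *m invmx A.
have -> : u *m P = a%:C%C *: (w *m P).
  rewrite -{1}[u](mulmxKV Au) -/w mul_regmx mulmxDl -scalemxAl mulmx_suml.
  by rewrite big1 ?addr0 // => j /kP h; rewrite -scalemxAl h scaler0.
rewrite nrm2Z sqn_real expr2 -mulrA ler_pM2l //.
apply: (@le_trans _ _ (a * nrm2 w)); first by rewrite ler_pM2l // nrm2_proj_le.
by rewrite rq_form lerDl sumr_ge0 // => j _; apply: sqn_ge0.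
Qed.

(** Ridge regression: the left side is the minimum over [c] of the right side. Split u = r + c U in
    the product with w = u A^-1 and bound each cross term by squares; the terms a^2 |w|^2 cancel. *)
Lemma rq_ridge u (c : 'rV[C]_n) : (forall j, j \notin S -> c 0 j = 0) ->
  a * rq A u <= nrm2 (u - c *m U) + a * nrm2 c.
Proof.
move=> cS; set r := u - c *m U; set w := u *m invmx A.
have e1 : rq A u = ip r w + ip (c *m U) w by rewrite -ipDl subrK ipC.
have e2 : 2 * a * ip r w <= nrm2 r + a ^+ 2 * nrm2 w.
  have := nrm2_ge0 (r - a%:C%C *: w).
  rewrite nrm2D nrm2N ipNr nrm2Z sqn_real ipZr.
  by move: (ip r w) (nrm2 r) (nrm2 w) => k1 k2 k3; nra.
have e3 : 2 * ip (c *m U) w <= nrm2 c + (rq A u - a * nrm2 w).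
  rewrite {1}rq_form -/w [X in _ + X]addrC addKr mulmx_sum_row ip_suml mulr_sumr.
  rewrite nrm2E [X in _ <= _ + X]big_mkcond -big_split; apply: ler_sum => j _.
  rewrite /ip -scalemxAl mxE /=; case: ifPn => jS.
    apply: le_trans (Re_mul_le _ _) _; rewrite lerD2l.
    by rewrite -[row j U *m _]adjK adjM adjK mxE sqn_conj !mxE.
  by rewrite cS // mul0r /= mulr0 sqn0 addr0.
have := ler_wpM2l (ltW a0) e3; move: e1 e2 {e3}.
move: (rq A u) (ip r w) (ip _ w) (nrm2 r) (nrm2 w) (nrm2 c) => k1 k2 k3 k4 k5 k6; nra.
Qed.

(** Positivity of the form at t u - v bounds the cross term. *)
Lemma rq_add u v t : 0 < t ->
  rq A (u + v) <= (1 + t) * rq A u + (1 + t^-1) * rq A v.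
Proof.
move=> t0; pose b := ip (u *m invmx A) v.
have bC : ip (v *m invmx A) u = b.
  by rewrite ip_mull adj_invmx regmx_adj ipC.
have eD : rq A (u + v) = rq A u + rq A v + 2 * b.
  by rewrite /rq mulmxDl !(ipDl, ipDr) bC -/b; ring.
have h := rq_ge0 (t%:C%C *: u - v).
rewrite /rq mulmxBl -scalemxAl ipDl !ipNl !ipDr !ipNr !ipZl !ipZr bC -/b in h.
rewrite -/(rq A u) -/(rq A v) in h.
have h2 : 2 * b <= t * rq A u + t^-1 * rq A v.
  rewrite -(ler_pM2l t0) mulrDr [t * (t^-1 * _)]mulrA divff ?gt_eqF // mul1r.
  by move: h {bC eD}; move: b (rq A u) (rq A v) => k1 k2 k3; nra.
rewrite eD !mulrDl !mul1r; move: h2 {h bC eD}.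
by move: (t^-1) b (rq A u) (rq A v) => k1 k2 k3 k4; lra.
Qed.

End Rq.

(** Invertibility and positivity are proved together, one row at a time: the determinant lemma needs
    the first and yields the second, as the new factor is 1 plus a nonnegative form. *)
Lemma regmx_det U S :
  regmx a U S \in unitmx /\ exists2 d : R, 0 < d & \det (regmx a U S) = d%:C%C.
Proof.
suff [d d0 e] : exists2 d : R, 0 < d & \det (regmx a U S) = d%:C%C.
  split; last by exists d.
  by rewrite unitmxE e unitfE fmorph_eq0 gt_eqF.
have [k] := ubnP #|S|; elim: k S => // k IH S.
have [->|[i iS]] := set_0Vmem S.
  move=> _; exists (a ^+ n); first by rewrite exprn_gt0.
  by rewrite /regmx big_set0 addr0 det_scalar rmorphXn.
rewrite (cardsD1 i) iS => cS; rewrite -(setD1K iS).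
have [|d d0 e] := IH (S :\ i); first by move: cS; lia.
have Au : regmx a U (S :\ i) \in unitmx by rewrite unitmxE e unitfE fmorph_eq0 gt_eqF.
rewrite regmx_U1 ?inE ?eqxx // det_add_rank1 // rq_complex // e.
exists (d * (1 + rq (regmx a U (S :\ i)) (row i U))).
  by rewrite mulr_gt0 // ltr_pwDl // rq_ge0.
by rewrite rmorphM rmorphD rmorph1.
Qed.

Lemma regmx_unit U S : regmx a U S \in unitmx.
Proof. by case: (regmx_det U S). Qed.

Lemma detr_gt0 U S : 0 < detr a U S.
Proof. by rewrite /detr; case: (regmx_det U S) => _ [d d0 ->]. Qed.

Lemma detr0 U : detr a U set0 = a ^+ n.
Proof. by rewrite /detr /regmx big_set0 addr0 det_scalar -rmorphXn. Qed.

Lemma detr_U1 U S i : i \notin S ->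
  detr a U (i |: S) = detr a U S * (1 + rq (regmx a U S) (row i U)).
Proof.
move=> iS; rewrite /detr regmx_U1 // det_add_rank1 ?regmx_unit //.
rewrite rq_complex ?regmx_unit //; case: (regmx_det U S) => _ [d d0 ->].
by rewrite -[1 in LHS](rmorph1 (real_complex R)) -rmorphD -rmorphM.
Qed.

Lemma eq_regmx U U' S : (forall j, j \in S -> row j U = row j U') ->
  regmx a U S = regmx a U' S.
Proof. by move=> h; congr (_ + _); apply: eq_bigr => j /h->. Qed.

End Regularization.

(** * Gram-Schmidt coefficients and the dual basis *)

Section DualBasis.
Variable R : rcfType.
Local Notation C := R[i].
Variables (n : nat) (U : 'M[C]_n) (P M : 'I_n -> 'M[C]_n) (m' : nat).
Hypothesis spP : forall i : 'I_n, span_proj U [set j : 'I_n | (j < i)%N] (P i) (M i).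
Hypothesis D_gt0 : forall i : 'I_n, (i < m')%N -> 0 < nrm2 (row i U *m P i).

Local Notation D i := (nrm2 (row i U *m P i)).

(** Coefficients of the [i]-th Gram-Schmidt vector in the rows of [U]: lower triangular with unit
    diagonal. *)
Definition gs_coef i : 'rV[C]_n := delta_mx 0 i - row i U *m M i.
Local Notation g := gs_coef.

Lemma gs_coefE i : g i *m U = row i U *m P i.
Proof. by rewrite mulmxBl -rowE (span_proj_decomp (spP i)). Qed.

Lemma gs_coef_supp (i j : 'I_n) : (i < j)%N -> g i 0 j = 0.
Proof.
move=> ij; rewrite !mxE eqxx /= [j == i]gtn_eqF //.
have /(_ (row i U) j) := @span_proj_supp _ _ _ _ _ _ (spP i).
by rewrite inE -leqNgt (ltnW ij) => /(_ isT); rewrite mxE => ->; rewrite subr0.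
Qed.

Lemma nrm2_gs_coef i : nrm2 (g i) = 1 + nrm2 (row i U *m M i).
Proof.
rewrite nrm2D nrm2N ipNr (nrm2E (delta_mx 0 i)) (bigD1 i) //= !mxE !eqxx sqn1.
rewrite big1 => [|j ji]; last by rewrite mxE (negbTE ji) andbF sqn0.
suff -> : ip (delta_mx 0 i) (row i U *m M i) = 0 by ring.
rewrite ipC /ip mxE (bigD1 i) //= (span_proj_supp (spP i)) ?inE ?ltnn // mul0r.
rewrite big1 ?addr0 // => j ji.
by rewrite !mxE (negbTE ji) andbF conjc0 mulr0.
Qed.

Lemma gs_orth (i l : 'I_n) : (l < i)%N -> (g l *m U) *m adj (g i *m U) = 0.
Proof.
move=> li; rewrite gs_coefE [in adj _]gs_coefE adjM.
have [[aP _] _ _ _ _] := spP i.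
rewrite aP mulmxA -gs_coefE (span_proj_comb0 (spP i)) ?mul0mx // => j.
by rewrite inE -leqNgt => ij; rewrite gs_coef_supp // (leq_trans li).
Qed.

Lemma gs_orthE (i l : 'I_n) :
  (g l *m U) *m adj (g i *m U) = (if l == i then (D i)%:C%C else 0)%:M.
Proof.
case: eqVneq => [->|/negP nli]; first by rewrite mulmx_adj_self gs_coefE.
have [li|il|/val_inj/eqP //] := ltngtP l i; first by rewrite gs_orth // raddf0.
by rewrite -[LHS]adjK adjM adjK gs_orth // adj0 raddf0.
Qed.

(* The combination w of the Gram-Schmidt vectors below is the dual vector of row j0:
   its coefficient along row j0 is |w|^2, hence |w| <= 1/dist. *)
Lemma dual_bound (j0 : 'I_n) (del : R) : (j0 < m')%N -> 0 < del ->
  (forall c : 'rV[C]_n, (forall j : 'I_n, ~~ ((j < m')%N && (j != j0)) -> c 0 j = 0) ->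
     del <= nrm2 (row j0 U - c *m U)) ->
  \sum_(i < n | (i < m')%N) sqn (g i 0 j0) / D i <= del^-1.
Proof.
move=> j0m del0 hdel; set kap := \sum_(i < n | _) _.
pose x (i : 'I_n) : C := ((g i 0 j0)^*)%C * ((D i)^-1)%:C%C.
pose gg : 'rV[C]_n := \sum_(i < n | (i < m')%N) x i *: g i.
have ggj0 : gg 0 j0 = kap%:C%C.
  rewrite /gg summxE rmorph_sum; apply: eq_bigr => i _.
  by rewrite mxE /x rmorphM /= -sqnE; ring.
have ggU : gg *m U = \sum_(i < n | (i < m')%N) x i *: (g i *m U).
  by rewrite mulmx_suml; apply: eq_bigr => i _; rewrite scalemxAl.
have nw : nrm2 (gg *m U) = kap.
  rewrite /nrm2 {1}ggU ip_suml; apply: eq_bigr => i im; set y := g i 0 j0.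
  rewrite /ip ggU adj_sum -scalemxAl mulmx_sumr (bigD1 i) //= big1 ?addr0.
    rewrite adjZ -scalemxAr gs_orthE eqxx scalerA !mxE eqxx mulr1n sqnE -rmorphM /=.
    rewrite /x -/y sqnM sqn_conj sqn_real; field; rewrite gt_eqF //; exact: D_gt0.
  move=> l /andP[_ li]; rewrite adjZ -scalemxAr gs_orthE eq_sym (negbTE li).
  by rewrite raddf0 scaler0.
have kap_ge0 : 0 <= kap.
  by apply: sumr_ge0 => i im; rewrite divr_ge0 ?sqn_ge0 ?nrm2_ge0.
have [kap0|kap0] := eqVneq kap 0; first by rewrite kap0 invr_ge0 ltW.
have kap_gt0 : 0 < kap by rewrite lt_def kap0.
(* The factor [kap^-1] makes the coefficient of [c] at [j0] vanish, so [c] is admissible in [hdel],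
   while row [j0] minus [c U] is [kap^-1] times [gg U], of squared length 1/kap. *)
pose c := delta_mx 0 j0 - (kap^-1)%:C%C *: gg.
have := hdel c; rewrite mulmxBl -rowE subKr -scalemxAl nrm2Z nw sqn_real => h.
have {h} : del <= kap^-1 ^+ 2 * kap.
  apply: h => j; rewrite negb_and negbK /c 4!mxE eqxx => /orP[mj|/eqP->] /=.
    have /negbTE -> : j != j0 by apply: contra mj => /eqP->.
    rewrite /gg summxE big1 ?mulr0 ?subr0 // => i im.
    by rewrite mxE gs_coef_supp ?mulr0 //; move: im mj; lia.
  by rewrite ggj0 eqxx -rmorphM mulVf // subrr.
have -> : kap^-1 ^+ 2 * kap = kap^-1 by rewrite expr2 -mulrA mulVf ?mulr1.
by move=> h; rewrite -[kap]invrK lef_pV2 ?posrE ?invr_gt0.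
Qed.

(** After exchanging the sums, each column [j0 < m'] is a squared dual vector, bounded by
    [dual_bound]; the other columns vanish by triangularity. *)
Lemma sum_gs_coef (del : R) : 0 < del ->
  (forall (j0 : 'I_n) (c : 'rV[C]_n), (j0 < m')%N ->
     (forall j : 'I_n, ~~ ((j < m')%N && (j != j0)) -> c 0 j = 0) ->
     del <= nrm2 (row j0 U - c *m U)) ->
  \sum_(i < n | (i < m')%N) nrm2 (g i) / D i <= n%:R / del.
Proof.
move=> del0 hdel.
have -> : \sum_(i < n | (i < m')%N) nrm2 (g i) / D i
        = \sum_(j0 < n) \sum_(i < n | (i < m')%N) sqn (g i 0 j0) / D i.
  by rewrite exchange_big; apply: eq_bigr => i _; rewrite nrm2E mulr_suml.
apply: (@le_trans _ _ (\sum_(j0 < n) del^-1)); last first.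
  by rewrite sumr_const card_ord mulr_natl.
apply: ler_sum => j0 _; have [j0m|mj0] := ltnP j0 m'.
  by apply: dual_bound => // c; apply: hdel.
rewrite big1 ?invr_ge0 ?ltW // => i im.
by rewrite gs_coef_supp ?sqn0 ?mul0r // (leq_trans im).
Qed.

(** This is [rq_ridge] at the coefficients of the projection; the unit diagonal entry of [gs_coef]
    absorbs the extra [a]. *)
Lemma ridge_gs (a : R) (i : 'I_n) : 0 < a ->
  a + a * rq (regmx a U [set j : 'I_n | (j < i)%N]) (row i U) <= D i + a * nrm2 (g i).
Proof.
move=> a0; have := @rq_ridge _ _ _ a0 U _ (regmx_unit a0 U _) (row i U) (row i U *m M i).
move=> /(_ [set j : 'I_n | (j < i)%N] (fun j => @span_proj_supp _ _ _ _ _ _ (spP i) _ j)).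
by rewrite -(span_proj_decomp (spP i)) nrm2_gs_coef; lra.
Qed.

End DualBasis.

(** * Product measures *)

Section ExpLn.
(* Otherwise the arguments of [exp] and [ln] are parsed in R_scope, with Stdlib's operations. *)
Arguments Rtrigo_def.exp _ : clear scopes.
Arguments Rpower.ln _ : clear scopes.
Local Notation exp := Rtrigo_def.exp.
Local Notation ln := Rpower.ln.

Lemma Rexp_gt0 x : 0 < exp x.
Proof. exact/RltP/Exp_prop.exp_pos. Qed.

Lemma RexpD x y : exp (x + y) = exp x * exp y.
Proof. exact: Exp_prop.exp_plus. Qed.

Lemma Rexp_ge1D x : 1 + x <= exp x.
Proof. exact/RleP/exp_ineq1_le. Qed.

Lemma RexpN x : exp (- x) = (exp x)^-1.
Proof.
have h : exp x * exp (- x) = 1 by rewrite -RexpD subrr; apply: Rtrigo_def.exp_0.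
by apply: (mulfI (lt0r_neq0 (Rexp_gt0 x))); rewrite h mulfV // gt_eqF ?Rexp_gt0.
Qed.

Lemma Rexp_le x y : x <= y -> exp x <= exp y.
Proof.
move=> xy; rewrite -[y](subrK x) RexpD ler_peMl ?(ltW (Rexp_gt0 _)) //.
by apply: le_trans (Rexp_ge1D _); rewrite lerDl subr_ge0.
Qed.

Lemma RexpX x k : exp (x *+ k) = exp x ^+ k.
Proof. by elim: k => [|k IH]; [exact: Rtrigo_def.exp_0 | rewrite mulrS RexpD IH exprS]. Qed.

Lemma Rexp_quad x : `|x| <= 2^-1 -> exp x <= 1 + x + 2 * x ^+ 2.
Proof.
rewrite ler_norml => /andP[h1 h2].
have h3 : 0 < 1 - x by lra.
have h4 : 1 - x <= (exp x)^-1 by rewrite -RexpN; apply: Rexp_ge1D.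
have h5 : exp x * (1 - x) <= 1.
  rewrite -[X in _ <= X](mulfV (lt0r_neq0 (Rexp_gt0 x))).
  by rewrite ler_pM2l ?Rexp_gt0.
(* Here (1 + x + 2 x^2)(1 - x) = 1 + x^2 (1 - 2 x), which is at least 1 for x <= 1/2. *)
rewrite -(ler_pM2r h3); apply: le_trans h5 _; nra.
Qed.

Lemma Rln_exp x : ln (exp x) = x.
Proof. exact: ln_exp. Qed.

Lemma Rexp_ln x : 0 < x -> exp (ln x) = x.
Proof. by move=> /RltP; apply: exp_ln. Qed.

Lemma Rln_le x y : 0 < x -> x <= y -> ln x <= ln y.
Proof.
move=> x0 xy; have y0 := lt_le_trans x0 xy; rewrite leNgt; apply/negP => h.
have := Rexp_le (ltW h); rewrite !Rexp_ln // => yx.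
by move: h; rewrite (_ : x = y) ?ltxx //; apply/eqP; rewrite eq_le xy yx.
Qed.

Lemma RlnM x y : 0 < x -> 0 < y -> ln (x * y) = ln x + ln y.
Proof. by move=> /RltP x0 /RltP y0; apply: ln_mult. Qed.

Lemma Rln1 : ln 1 = 0.
Proof. exact: ln_1. Qed.

Lemma Rln_le_exp x y : 0 < x -> x <= exp y -> ln x <= y.
Proof. by move=> x0 /(Rln_le x0); rewrite Rln_exp. Qed.

Lemma Rln1D_le x : 0 <= x -> ln (1 + x) <= x.
Proof. by move=> x0; apply: Rln_le_exp (Rexp_ge1D x); rewrite ltr_pwDl. Qed.

Lemma Rln_ge0 x : 1 <= x -> 0 <= ln x.
Proof. by move=> x1; rewrite -Rln1; apply: Rln_le. Qed.

Lemma RlnX x k : 0 < x -> ln (x ^+ k) = k%:R * ln x.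
Proof.
move=> x0; elim: k => [|k IH]; first by rewrite expr0 Rln1 mul0r.
by rewrite exprS RlnM ?exprn_gt0 // IH -natr1; ring.
Qed.

Lemma Rln_prod (I : finType) (P : pred I) (F : I -> RR) :
  (forall i, P i -> 0 < F i) ->
  ln (\prod_(i | P i) F i) = \sum_(i | P i) ln (F i).
Proof.
move=> F0; have [_ //] : 0 < \prod_(i | P i) F i /\
  ln (\prod_(i | P i) F i) = \sum_(i | P i) ln (F i).
elim/big_rec2: _ => [|i x y Pi [y0 <-]]; first by rewrite Rln1.
by split; [rewrite mulr_gt0 ?F0 | rewrite RlnM ?F0].
Qed.

End ExpLn.

(** * Expectation, concentration and replacement under product laws *)

Section ProductMeasure.
Arguments Rtrigo_def.exp _ : clear scopes.
Arguments Rpower.ln _ : clear scopes.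
Local Notation exp := Rtrigo_def.exp.
Variables (I T : finType).
Implicit Types (w : T -> RR) (X Y : {ffun I -> T}) (f : {ffun I -> T} -> RR) (i j : I).

Definition prob (S : finType) (w : S -> RR) := (forall y, 0 <= w y) /\ \sum_y w y = 1.

Lemma mean_le (S : finType) (w g : S -> RR) b : prob w -> (forall y, 0 < w y -> g y <= b) ->
  \sum_y w y * g y <= b.
Proof.
case=> w0 w1 gb; rewrite -[b]mul1r -w1 mulr_suml; apply: ler_sum => y _.
have := w0 y; rewrite le_eqVlt => /orP[/eqP<-|wy]; first by rewrite !mul0r.
by rewrite ler_pM2l // gb.
Qed.

Definition upd X i y : {ffun I -> T} := [ffun j => if j == i then y else X j].
Definition pw w X : RR := \prod_i w (X i).
Definition Ex w f : RR := \sum_X pw w X * f X.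
Definition Pr w (A : pred {ffun I -> T}) : RR := Ex w (fun X => (A X)%:R).
(** Conditional expectation given the other coordinates. It remains a function of the full
    configuration, so that averages along several coordinates compose. *)
Definition E1 w i f X : RR := \sum_y w y * f (upd X i y).
Definition EE w (r : seq I) f := foldl (fun f i => E1 w i f) f r.

Lemma upd_same X i y z : upd (upd X i y) i z = upd X i z.
Proof. by apply/ffunP => j; rewrite !ffunE; case: eqP. Qed.

Lemma upd_id X i : upd X i (X i) = X.
Proof. by apply/ffunP => j; rewrite !ffunE; case: eqP => [->|]. Qed.

Lemma updC X i j y z : i != j -> upd (upd X i y) j z = upd (upd X j z) i y.
Proof.
move=> ij; apply/ffunP => k; rewrite !ffunE; case: eqP => // ->.
by rewrite eq_sym (negbTE ij).
Qed.

Lemma upd_at X i y : upd X i y i = y.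
Proof. by rewrite ffunE eqxx. Qed.

Lemma prob_pw w : prob w -> prob (pw w).
Proof.
case=> w0 w1; split=> [X|]; first by rewrite prodr_ge0.
have := @bigA_distr_bigA RR 0 1 *%R +%R I T (fun _ y => w y).
rewrite /pw => <-; rewrite big1 //.
Qed.

Lemma prob_inhabited w : prob w -> inhabited {ffun I -> T}.
Proof.
move=> /prob_pw[_ pw1]; case: (pickP (fun _ : {ffun I -> T} => true)) => [X _|h].
  exact: (inhabits X).
by move: pw1; rewrite big1 => [/eqP|X _]; [rewrite eq_sym oner_eq0 | have := h X].
Qed.

Lemma Ex_le w f g : prob w -> (forall X, f X <= g X) -> Ex w f <= Ex w g.
Proof.
move=> hw fg; apply: ler_sum => X _; apply: ler_wpM2l => //.
by case: (prob_pw hw).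
Qed.

Lemma Ex_const w b : prob w -> Ex w (fun _ => b) = b.
Proof. by move=> hw; rewrite /Ex -mulr_suml; case: (prob_pw hw) => _ ->; rewrite mul1r. Qed.

Lemma ExN w f : Ex w (fun X => - f X) = - Ex w f.
Proof. by rewrite /Ex -sumrN; apply: eq_bigr => X _; rewrite mulrN. Qed.

Lemma ExZ w b f : Ex w (fun X => b * f X) = b * Ex w f.
Proof. by rewrite /Ex mulr_sumr; apply: eq_bigr => X _; ring. Qed.

Lemma ExD w f g : Ex w (fun X => f X + g X) = Ex w f + Ex w g.
Proof. by rewrite /Ex -big_split; apply: eq_bigr => X _; rewrite mulrDr. Qed.

Lemma Ex_sum w (J : finType) (P : pred J) (F : J -> {ffun I -> T} -> RR) :
  Ex w (fun X => \sum_(k | P k) F k X) = \sum_(k | P k) Ex w (F k).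
Proof.
by rewrite /Ex exchange_big /=; apply: eq_bigr => X _; rewrite mulr_sumr.
Qed.

(* Swapping the resampled coordinate with the old one is a measure-preserving involution. *)
Lemma Ex_E1 w i f : \sum_y w y = 1 -> Ex w (E1 w i f) = Ex w f.
Proof.
move=> w1; rewrite /Ex /E1.
under eq_bigr => X _ do rewrite mulr_sumr.
rewrite pair_bigA /=.
pose s (p : {ffun I -> T} * T) := (upd p.1 i p.2, p.1 i).
have sK : involutive s.
  by case=> X y; rewrite /s /= upd_same upd_id upd_at.
rewrite (reindex_inj (inv_inj sK)) /= -(pair_bigA _ (fun X y =>
  pw w (upd X i y) * (w (X i) * f (upd (upd X i y) i (X i))))) /=.
apply: eq_bigr => X _.
rewrite -[RHS]mulr1 -w1 mulr_sumr; apply: eq_bigr => y _.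
rewrite upd_same upd_id; suff : pw w (upd X i y) * w (X i) = pw w X * w y.
  by move=> e; rewrite mulrA e; ring.
rewrite /pw (bigD1 i) //= (bigD1 i (P := predT)) //= upd_at.
rewrite (eq_bigr (fun j => w (X j))); first by ring.
by move=> j ji; rewrite ffunE (negbTE ji).
Qed.

Lemma Ex_EE w r f : \sum_y w y = 1 -> Ex w (EE w r f) = Ex w f.
Proof. by move=> w1; elim: r f => //= i r IH f; rewrite IH Ex_E1. Qed.

Definition indep f i := forall X y, f (upd X i y) = f X.

Lemma indep_E1 w f i : indep (E1 w i f) i.
Proof. by move=> X y; apply: eq_bigr => z _; rewrite upd_same. Qed.

Lemma E1_indep w f i X : \sum_y w y = 1 -> indep f i -> E1 w i f X = f X.
Proof.
move=> w1 fi; rewrite /E1; under eq_bigr => y _ do rewrite fi.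
by rewrite -mulr_suml w1 mul1r.
Qed.

Lemma indep_E1_other w f i j : indep f j -> indep (E1 w i f) j.
Proof.
move=> fj X y; have [->|ij] := eqVneq i j; first exact: indep_E1.
by apply: eq_bigr => z _; rewrite updC 1?eq_sym // fj.
Qed.

Lemma indep_EE w f r j : j \in r \/ indep f j -> indep (EE w r f) j.
Proof.
elim: r f => [|i r IH] f; first by case.
rewrite inE => h; change (indep (EE w r (E1 w i f)) j); apply: IH.
case: h => [/orP[/eqP->|jr]|fj]; [right|by left|right].
  exact: indep_E1.
exact: indep_E1_other.
Qed.

Lemma indep_const f : (forall i, indep f i) -> forall X Y, f X = f Y.
Proof.
move=> fi X Y; pose hyb (r : seq I) : {ffun I -> T} := [ffun j => if j \in r then Y j else X j].
have h r : f (hyb r) = f X.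
  elim: r => [|i r <-]; first by congr f; apply/ffunP => j; rewrite ffunE.
  rewrite -(fi i (hyb r) (Y i)); congr f; apply/ffunP => j; rewrite !ffunE inE.
  by case: eqP => [->|].
by rewrite -(h (enum I)); congr f; apply/ffunP => j; rewrite ffunE mem_enum.
Qed.

(** Once every coordinate is averaged out the function is constant, hence equal to its own mean, and
    averaging preserves the mean. *)
Lemma EE_enum w f X : prob w -> EE w (enum I) f X = Ex w f.
Proof.
move=> hw; rewrite -(Ex_EE (enum I) f hw.2) -[LHS](Ex_const _ hw).
apply: eq_bigr => Y _; congr (_ * _); apply: indep_const => i.
by apply: indep_EE; left; rewrite mem_enum.
Qed.

Lemma EE_ext w r f g : f =1 g -> EE w r f =1 EE w r g.
Proof.
elim: r f g => //= i r IH f g fg; apply: IH => X.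
by apply: eq_bigr => y _; rewrite fg.
Qed.

Lemma EE_le w r f g : prob w -> (forall X, f X <= g X) -> forall X, EE w r f X <= EE w r g X.
Proof.
move=> hw; elim: r f g => //= i r IH f g fg; apply: IH => X.
by apply: ler_sum => y _; rewrite ler_wpM2l // hw.1.
Qed.

Lemma EEZ w r b f X : EE w r (fun X => b * f X) X = b * EE w r f X.
Proof.
elim: r f X => //= i r IH f X; rewrite -IH; apply: EE_ext => Y.
by rewrite /E1 mulr_sumr; apply: eq_bigr => y _; ring.
Qed.

(** The mean lies within [c] of every value of [g], so the quadratic bound on [exp] applies to the
    centred variable; its linear term averages to 0. *)
Lemma hoeffding (w : T -> RR) (g : T -> RR) lam c : prob w ->
  (forall y z, g y - g z <= c) -> 0 <= lam -> lam * c <= 2^-1 ->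
  \sum_y w y * exp (lam * g y)
    <= exp (2 * lam ^+ 2 * c ^+ 2) * exp (lam * \sum_y w y * g y).
Proof.
move=> hw gc lam0 lamc; have [w0 w1] := hw; set mu := \sum_y w y * g y.
have gmu y : `|g y - mu| <= c.
  rewrite ler_norml; apply/andP; split.
    suff: mu <= g y + c by lra.
    by apply: mean_le => // z _; have := gc z y; lra.
  suff: - mu <= c - g y by lra.
  have -> : - mu = \sum_z w z * - g z.
    by rewrite /mu -sumrN; apply: eq_bigr => z _; rewrite mulrN.
  by apply: mean_le => // z _; have := gc y z; lra.
have -> : \sum_y w y * exp (lam * g y)
        = exp (lam * mu) * \sum_y w y * exp (lam * (g y - mu)).
  rewrite mulr_sumr; apply: eq_bigr => y _.
  by rewrite [RHS]mulrCA -RexpD; congr (_ * exp _); ring.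
rewrite mulrC ler_pM2r ?Rexp_gt0 //.
apply: le_trans (Rexp_ge1D _).
have -> : 1 + 2 * lam ^+ 2 * c ^+ 2
        = \sum_y w y * (1 + lam * (g y - mu) + 2 * lam ^+ 2 * c ^+ 2).
  under [RHS]eq_bigr => y _ do rewrite !mulrDr mulrN mulrCA mulrN [w y * (lam * mu)]mulrCA.
  rewrite !big_split /= -!mulr_suml w1 -!mulr_sumr -/mu sumrN -mulr_sumr.
  by rewrite -mulr_suml w1; ring.
apply: ler_sum => y _; apply: ler_wpM2l => //.
have hx : `|lam * (g y - mu)| <= 2^-1.
  rewrite normrM ger0_norm //; apply: le_trans lamc; exact: ler_wpM2l.
apply: le_trans (Rexp_quad hx) _; rewrite lerD2l -mulrA ler_pM2l // exprMn.
rewrite ler_wpM2l ?sqr_ge0 //; have := gmu y; rewrite ler_norml => /andP[? ?]; nra.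
Qed.

Definition bdiff f c := forall i X y z, f (upd X i y) - f (upd X i z) <= c.

Lemma bdiff_E1 w f c i : prob w -> bdiff f c -> bdiff (E1 w i f) c.
Proof.
move=> hw fc j X y z; have [->|ij] := eqVneq i j.
  rewrite !indep_E1 subrr; have := fc j X y y; by rewrite subrr.
rewrite /E1 -sumrB; under eq_bigr => u _ do rewrite -mulrBr.
by apply: mean_le => // u _; rewrite ![upd (upd X j _) i u]updC 1?eq_sym.
Qed.

(** The martingale argument as an induction on [r]: averaging one coordinate costs one factor by
    [hoeffding], and the averaged function keeps the same bounded differences. *)
Lemma EE_exp_le w r f lam c : prob w -> bdiff f c -> 0 <= lam -> lam * c <= 2^-1 ->
  forall X, EE w r (fun X => exp (lam * f X)) X
    <= exp (2 * lam ^+ 2 * c ^+ 2) ^+ size r * exp (lam * EE w r f X).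
Proof.
move=> hw fc lam0 lamc; elim: r f fc => [|i r IH] f fc X /=; first by rewrite mul1r.
set K := exp (2 * _ * _).
apply: (@le_trans _ _ (EE w r (fun X => K * exp (lam * E1 w i f X)) X)).
  apply: EE_le => // Y; apply: hoeffding => // y z; exact: fc.
rewrite EEZ exprS -mulrA ler_pM2l ?Rexp_gt0 //.
by apply: IH; apply: bdiff_E1.
Qed.

Lemma Ex_exp_le w f lam c : prob w -> bdiff f c -> 0 <= lam -> lam * c <= 2^-1 ->
  Ex w (fun X => exp (lam * f X))
    <= exp (#|I|%:R * (2 * lam ^+ 2 * c ^+ 2) + lam * Ex w f).
Proof.
move=> hw fc lam0 lamc; have [X0] := prob_inhabited hw.
have := @EE_exp_le w (enum I) f lam c hw fc lam0 lamc X0.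
by rewrite !EE_enum // -cardE RexpD -RexpX (mulr_natl _ #|I|).
Qed.

Lemma Pr_le w (A B : pred {ffun I -> T}) : prob w -> (forall X, A X -> B X) -> Pr w A <= Pr w B.
Proof.
move=> hw AB; apply: Ex_le => // X; rewrite ler_nat.
by have := AB X; case: (A X) => // /(_ isT)->.
Qed.

Lemma Pr_U w (A B : pred {ffun I -> T}) : prob w -> Pr w (fun X => A X || B X) <= Pr w A + Pr w B.
Proof.
move=> hw; rewrite /Pr -ExD; apply: Ex_le => // X.
by rewrite -natrD ler_nat; case: (A X); case: (B X).
Qed.

Lemma Pr_exists w (J : finType) (A : J -> pred {ffun I -> T}) (b : RR) : prob w ->
  (forall k, Pr w (A k) <= b) -> Pr w (fun X => [exists k, A k X]) <= #|J|%:R * b.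
Proof.
move=> hw Ab; have -> : #|J|%:R * b = \sum_(k : J) b by rewrite sumr_const mulr_natl.
apply: le_trans (ler_sum _ (fun k _ => Ab k)); rewrite /Pr -Ex_sum.
apply: Ex_le => // X; rewrite -natr_sum ler_nat.
by case: existsP => // -[k hk]; rewrite (bigD1 k) //= hk.
Qed.

Lemma Pr_coord w i (A : pred {ffun I -> T}) b : prob w ->
  (forall X, \sum_y w y * (A (upd X i y))%:R <= b) -> Pr w A <= b.
Proof.
move=> hw h; rewrite /Pr -(Ex_E1 i _ hw.2) -[b](Ex_const _ hw).
exact: Ex_le.
Qed.

Lemma Pr_chernoff w f lam c s : prob w -> bdiff f c -> 0 <= lam -> lam * c <= 2^-1 ->
  Pr w (fun X => s <= f X - Ex w f)
    <= exp (#|I|%:R * (2 * lam ^+ 2 * c ^+ 2) - lam * s).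
Proof.
move=> hw fc lam0 lamc.
have h := Ex_exp_le hw fc lam0 lamc.
apply: (@le_trans _ _ (exp (- lam * (s + Ex w f)) * Ex w (fun X => exp (lam * f X)))).
  rewrite -ExZ; apply: Ex_le => // X; rewrite -RexpD; have [hs|hs] := boolP (s <= f X - Ex w f).
    rewrite (_ : true%:R = 1) //; apply: le_trans (Rexp_ge1D _).
    by rewrite lerDl -(addrC (lam * _)) mulNr -mulrBr mulr_ge0 //; lra.
  by rewrite ltW ?Rexp_gt0.
apply: le_trans (ler_wpM2l (ltW (Rexp_gt0 _)) h) _.
by rewrite -RexpD le_eqVlt; apply/orP; left; apply/eqP; congr exp; ring.
Qed.

Lemma mcdiarmid w f lam c s : prob w -> bdiff f c -> 0 <= lam -> lam * c <= 2^-1 ->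
  Pr w (fun X => s <= `|f X - Ex w f|)
    <= 2 * exp (#|I|%:R * (2 * lam ^+ 2 * c ^+ 2) - lam * s).
Proof.
move=> hw fc lam0 lamc.
have fc' : bdiff (fun X => - f X) c.
  by move=> i X y z; have := fc i X z y; lra.
have h1 := @Pr_chernoff w f lam c s hw fc lam0 lamc.
have h2 := @Pr_chernoff w (fun X => - f X) lam c s hw fc' lam0 lamc.
apply: (@le_trans _ _ (Pr w (fun X => (s <= f X - Ex w f) ||
   (s <= - f X - Ex w (fun X => - f X))))).
  apply: Pr_le => // X; rewrite ExN => h; apply/orP.
  by have [h0|h0] := lerP 0 (f X - Ex w f); [left|right];
    move: h; rewrite ?(ger0_norm h0) ?(ltr0_norm h0); lra.
by apply: le_trans (Pr_U _ _ hw) _; lra.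
Qed.

Lemma E1_comm w w' i j f : i != j -> E1 w i (E1 w' j f) =1 E1 w' j (E1 w i f).
Proof.
move=> ij X; rewrite /E1; under eq_bigr => y _ do rewrite mulr_sumr.
rewrite exchange_big /=; apply: eq_bigr => z _; rewrite mulr_sumr.
by apply: eq_bigr => y _; rewrite updC // mulrCA.
Qed.

Lemma E1_abs_le w i f b : prob w -> (forall X, `|f X| <= b) -> forall X, `|E1 w i f X| <= b.
Proof.
move=> hw fb X; apply: le_trans (ler_norm_sum _ _ _) _.
under eq_bigr => y _ do rewrite normrM ger0_norm ?hw.1 //.
exact: mean_le.
Qed.

(** Telescoping over the coordinates. The hypothesis survives averaging along [i]: for another
    coordinate the two averages commute, and along [i] itself nothing depends on the law any
    more. *)
Lemma lindeberg w w' f eta : prob w -> prob w' -> 0 <= eta ->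
  (forall i X, `|E1 w i f X - E1 w' i f X| <= eta) ->
  `|Ex w f - Ex w' f| <= #|I|%:R * eta.
Proof.
move=> hw hw' eta0 hf.
have key r : forall g, (forall i X, `|E1 w i g X - E1 w' i g X| <= eta) ->
    forall X, `|EE w r g X - EE w' r g X| <= (size r)%:R * eta.
  elim: r => [|i r IH] g hg X; first by rewrite /= subrr normr0 mul0r.
  change (`|EE w r (E1 w i g) X - EE w' r (E1 w' i g) X| <= (size r).+1%:R * eta).
  have -> : EE w r (E1 w i g) X - EE w' r (E1 w' i g) X
    = (EE w r (E1 w i g) X - EE w r (E1 w' i g) X)
      + (EE w r (E1 w' i g) X - EE w' r (E1 w' i g) X) by ring.
  rewrite -natr1 mulrDl mul1r addrC; apply: le_trans (ler_normD _ _) _.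
  apply: lerD; first apply: IH => j Y.
    have [<-|ij] := eqVneq i j.
      have ind := @indep_E1 w' g i.
      by rewrite (E1_indep Y hw.2 ind) (E1_indep Y hw'.2 ind) subrr normr0.
    have ji : j != i by rewrite eq_sym.
    rewrite (E1_comm w w' g ji Y) (E1_comm w' w' g ji Y).
    have -> : E1 w' i (E1 w j g) Y - E1 w' i (E1 w' j g) Y
            = E1 w' i (fun Z => E1 w j g Z - E1 w' j g Z) Y.
      by rewrite /E1 -sumrB; apply: eq_bigr => y _; rewrite mulrBr.
    exact: E1_abs_le.
  (* Averaging is monotone and leaves the constant [eta] unchanged. *)
  have sub h1 h2 : (forall Z, h1 Z - h2 Z <= eta) ->
      EE w r h1 X - EE w r h2 X <= eta.
    move=> h12; rewrite lerBlDr; apply: (@le_trans _ _ (EE w r (fun Z => eta + h2 Z) X)).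
      by apply: EE_le => // Z; rewrite -lerBlDr.
    rewrite le_eqVlt; apply/orP; left; apply/eqP.
    elim: (r) (h2) => //= k r' IH' h; rewrite -IH'; apply: EE_ext => Z.
    rewrite /E1; under eq_bigr => y _ do rewrite mulrDr.
    by rewrite big_split /= -mulr_suml hw.2 mul1r.
  rewrite ler_norml; apply/andP; split.
    rewrite -lerN2 opprK opprB; apply: sub => Z.
    by have := hg i Z; rewrite ler_norml => /andP[]; lra.
  apply: sub => Z; by have := hg i Z; rewrite ler_norml => /andP[].
have [X0] := prob_inhabited hw.
by rewrite cardE -(EE_enum f X0 hw) -(EE_enum f X0 hw'); apply: key.
Qed.

End ProductMeasure.

(** * Small ball estimate *)

Section Cube.
Arguments Rtrigo_def.exp _ : clear scopes.
Arguments Rpower.ln _ : clear scopes.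
Local Notation exp := Rtrigo_def.exp.
Local Notation C := RR[i].
Local Notation Re := complex.Re.
Variable n : nat.
Implicit Types (x y : {ffun 'I_n -> bool}) (p q : RR).

Definition bw p (b : bool) := if b then p else 1 - p.

Definition xrow x : 'rV[C]_n := \row_j ((sgn (x j))%:C)%C.

Lemma prob_bw p : 0 <= p <= 1 -> prob (bw p).
Proof.
move=> /andP[p0 p1]; split; first by case=> /=; lra.
by rewrite big_bool /=; ring.
Qed.

Lemma xrow_upd x i b :
  xrow (upd x i b) = xrow x + ((sgn b - sgn (x i))%:C)%C *: delta_mx 0 i.
Proof.
apply/rowP=> j; rewrite !mxE eqxx ffunE; case: eqP => [->|_] /=.
  by rewrite mulr1 -rmorphD /= addrC subrK.
by rewrite mulr0 addr0.
Qed.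

Lemma exists_large_diag (P : 'M[C]_n) (k : RR) : 0 < k -> k <= Re (\tr P) ->
  exists i, k / n%:R <= Re (P i i).
Proof.
move=> k0 tP; apply/not_existsP => h.
have : Re (\tr P) < k; last by rewrite ltNge tP.
have n0 : (0 < n)%N.
  by case: (n) P tP h => // P; rewrite /mxtrace big_ord0 /= => h; move: (lt_le_trans k0 h); rewrite ltxx.
rewrite /mxtrace Re_sum.
have -> : k = \sum_(i < n) k / n%:R.
  by rewrite sumr_const card_ord -mulr_natl; field; rewrite pnatr_eq0 -lt0n.
apply: ltr_sum => [|i _]; last by rewrite ltNge; apply/negP/h.
by apply/hasP; exists (Ordinal n0); rewrite // mem_index_enum.
Qed.

(** Both outcomes have weight at least [q], so the one whose value is at most [th] gains at least q
    (1 - th). *)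
Lemma two_point_mix p q th et ef : 0 <= q -> q <= p -> p <= 1 - q ->
  et <= 1 -> ef <= 1 -> th <= 1 -> et <= th \/ ef <= th ->
  p * et + (1 - p) * ef <= 1 - q + q * th.
Proof. by move=> q0 qp pq et1 ef1 th1 [h|h]; nra. Qed.

(* Conditionally on the other coordinates, the two values of x_i move y P along the
   deflated direction by 2|h|, so at least one of them leaves a component of size |h|. *)
Lemma small_ball_exp p q (f : 'rV[C]_n) lam k0 j (P : 'M[C]_n) :
  0 <= q -> q <= p -> p <= 1 - q -> 0 < k0 -> 0 <= lam -> orthoproj P ->
  k0 + j%:R <= Re (\tr P) ->
  Ex (bw p) (fun x => exp (- lam * nrm2 ((xrow x + f) *m P)))
    <= (1 - q + q * exp (- lam * (k0 / n%:R))) ^+ j.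
Proof.
move=> q0 qp pq k00 lam0.
have hp : prob (bw p) by apply: prob_bw; lra.
set th := exp (- lam * (k0 / n%:R)).
have th1 : th <= 1.
  rewrite /th -[X in _ <= X]Rtrigo_def.exp_0; apply: Rexp_le.
  by rewrite mulNr oppr_le0 mulr_ge0 // divr_ge0 ?ler0n // ltW.
have th0 : 0 < th by apply: Rexp_gt0.
elim: j P => [|j IH] P oP tP.
  rewrite expr0 -[X in _ <= X](@Ex_const 'I_n bool (bw p) 1 hp); apply: Ex_le => // x.
  rewrite -[X in _ <= X]Rtrigo_def.exp_0; apply: Rexp_le.
  by rewrite mulNr oppr_le0 mulr_ge0 ?nrm2_ge0.
have jn : 0 <= j%:R :> RR by apply: ler0n.
(* Each of the [j] deflations lowers the trace by 1, so it stays at least [k0] and some diagonal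
   entry is at least k0/n. *)
have [i Pi] : exists i, k0 / n%:R <= Re (P i i).
  by apply: exists_large_diag => //; move: tP; rewrite -natr1; lra.
pose d := delta_mx 0 i : 'rV[C]_n; pose h := d *m P.
have hPh : h *m P = h by rewrite /h -mulmxA oP.2.
have Nh : nrm2 h = Re (P i i).
  rewrite (nrm2_proj _ oP) /ip /d -rowE mxE (bigD1 i) //= big1 ?addr0 => [|l li].
    by rewrite !mxE !eqxx conjc1 mulr1.
  by rewrite !mxE (negbTE li) andbF conjc0 mulr0.
have n0 : (0 < n)%N by apply: leq_ltn_trans (ltn_ord i).
have kn : 0 < k0 / n%:R by rewrite divr_gt0 // ltr0n.
have N0 : 0 < nrm2 h by rewrite Nh; apply: lt_le_trans Pi.
have h0 : h != 0 by apply/eqP => h0; move: N0; rewrite h0 nrm20 ltxx.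
have oP' := deflate_orthoproj oP hPh h0.
have dh : (d *m adj h) 0 0 = (nrm2 h)%:C%C.
  have Ph : P *m adj h = adj h by move: (congr1 (@adj _ _ _) hPh); rewrite adjM oP.1.
  by rewrite -Ph mulmxA mulmx_adj_self mxE eqxx mulr1n.
rewrite -(Ex_E1 i _ hp.2).
pose F x := exp (- lam * nrm2 ((xrow x + f) *m deflate P h)).
apply: (@le_trans _ _ (Ex (bw p) (fun x => (1 - q + q * th) * F x))); last first.
  rewrite ExZ exprS ler_wpM2l //; first by nra.
  apply: IH => //; rewrite deflate_tr //; move: tP; rewrite -natr1; lra.
apply: Ex_le => // x; rewrite /E1 big_bool /=.
pose s b := sqn (((xrow (upd x i b) + f) *m adj h) 0 0) / nrm2 h.
(* The deflated projection kills the direction of coordinate [i], so [F] does not see the resampled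
   value and factors out. *)
have eF b : exp (- lam * nrm2 ((xrow (upd x i b) + f) *m P)) = F x * exp (- lam * s b).
  rewrite -RexpD (deflate_nrm2 oP hPh h0); congr exp.
  suff -> : (xrow (upd x i b) + f) *m deflate P h = (xrow x + f) *m deflate P h.
    by rewrite /s; ring.
  have kd : d *m deflate P h = 0 by apply: deflate_kill.
  by rewrite xrow_upd addrAC mulmxDl -scalemxAl kd scaler0 addr0.
rewrite (eF true) (eF false).
have s0 b : 0 <= s b by rewrite divr_ge0 ?sqn_ge0 // ltW.
have e1 b : exp (- lam * s b) <= 1.
  rewrite -[X in _ <= X]Rtrigo_def.exp_0; apply: Rexp_le.
  by rewrite mulNr oppr_le0 mulr_ge0.
have eth b : nrm2 h <= s b -> exp (- lam * s b) <= th.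
  move=> hs; apply: Rexp_le; rewrite !mulNr lerN2; apply: ler_wpM2l => //.
  by apply: le_trans hs; rewrite Nh.
have Fx : 0 < F x by apply: Rexp_gt0.
have : nrm2 h <= s true \/ nrm2 h <= s false.
  set zt := ((xrow (upd x i true) + f) *m adj h) 0 0.
  set zf := ((xrow (upd x i false) + f) *m adj h) 0 0.
  have ez : zt - zf = (2 * nrm2 h)%:C%C.
    have -> : zt - zf = ((xrow (upd x i true) - xrow (upd x i false)) *m adj h) 0 0.
      have lin (A B : 'rV[C]_n) : (A *m adj h) 0 0 - (B *m adj h) 0 0 = ((A - B) *m adj h) 0 0.
        by rewrite mulmxBl [RHS]mxE [X in _ = _ + X]mxE.
      by rewrite /zt /zf lin opprD addrACA subrr addr0.
    have -> : xrow (upd x i true) - xrow (upd x i false) = (2%:C)%C *: d.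
      rewrite !xrow_upd opprD addrACA subrr add0r -scalerBl -rmorphB /=.
      by congr (_%:C%C *: _); ring.
    by rewrite -scalemxAl mxE dh -rmorphM.
  (* With N = |h|^2 this reads 4 N^2 <= 2 |zt|^2 + 2 |zf|^2, so one of |zt|^2 and |zf|^2 is at least
     N^2. *)
  have := sqnD_le zt (- zf); rewrite ez sqn_real sqnN => hz.
  have [|hlt] := lerP (nrm2 h) (s true); [by left|right].
  move: hlt; rewrite /s -/zt -/zf ltr_pdivrMr // ler_pdivlMr // => hlt.
  rewrite -expr2 in hlt *; move: hz hlt; clear.
  by move: (nrm2 h) (sqn zt) (sqn zf) => k1 k2 k3; nra.
move=> hs; have hth : exp (- lam * s true) <= th \/ exp (- lam * s false) <= th.
  by case: hs => /eth; [left|right].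
rewrite mulrCA [(1 - p) * _]mulrCA -mulrDr mulrC ler_pM2r //.
exact: two_point_mix.
Qed.

(** Markov's inequality for the exponential moment. Half of the trace is spent on deflations; the
    other half keeps the diagonal entries at least K/(2n). *)
Lemma small_ball p q (f : 'rV[C]_n) (P : 'M[C]_n) (K : nat) :
  0 < q -> q <= p -> p <= 1 - q -> (0 < K)%N -> orthoproj P ->
  K%:R <= Re (\tr P) ->
  Pr (bw p) (fun x => nrm2 ((xrow x + f) *m P) <= q * K%:R ^+ 2 / (16 * n%:R))
    <= exp (1 - q * K%:R / 8).
Proof.
move=> q0 qp pq K0 oP tP; set t := _ / (16 * n%:R).
have hp : prob (bw p) by apply: prob_bw; lra.
have K0r : 0 < K%:R :> RR by rewrite ltr0n.
have n0 : (0 < n)%N.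
  have [i _] := exists_large_diag K0r tP; exact: leq_ltn_trans (ltn_ord i).
have n0r : 0 < n%:R :> RR by rewrite ltr0n.
have hK : K%:R = (K./2)%:R + (K./2)%:R + (odd K)%:R :> RR.
  by rewrite -!natrD; congr (_%:R); lia.
have o1 : (odd K)%:R <= 1 :> RR by rewrite lern1; case: odd.
have o0 : 0 <= (odd K)%:R :> RR by rewrite ler0n.
(* Chosen so that lam (K/2)/n = 1; then lam t = q K/8, half of the gain q K/4 from the
   deflations. *)
pose lam := (2 * n%:R / K%:R)%R : RR.
have lam0 : 0 <= lam by rewrite /lam divr_ge0 ?mulr_ge0 ?ler0n.
have hE k0 := @small_ball_exp p q f lam k0 K./2 P (ltW q0) qp pq.
have k2 : 0 < K%:R / 2 :> RR by lra.
have kt : K%:R / 2 + (K./2)%:R <= Re (\tr P) by lra.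
have {hE} hE := hE _ k2 lam0 oP kt.
have eth : - lam * (K%:R / 2 / n%:R) = -1.
  by rewrite /lam; field; rewrite !gt_eqF.
rewrite eth in hE.
have e2 : exp (-1) <= 2^-1.
  rewrite RexpN lef_pV2 ?posrE ?Rexp_gt0 //.
  by apply: le_trans (Rexp_ge1D _).
have base : 1 - q + q * exp (-1) <= exp (- (q / 2)).
  apply: le_trans (Rexp_ge1D _); nra.
have base0 : 0 <= 1 - q + q * exp (-1) by have := Rexp_gt0 (-1); nra.
apply: (@le_trans _ _ (exp (lam * t) * exp (- (q / 2)) ^+ K./2)).
  apply: (@le_trans _ _ (exp (lam * t) * (1 - q + q * exp (-1)) ^+ K./2)); last first.
    by rewrite ler_pM2l ?Rexp_gt0 //; apply: lerXn2r; rewrite ?nnegrE // ltW ?Rexp_gt0.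
  apply: le_trans (ler_wpM2l (ltW (Rexp_gt0 _)) hE).
  rewrite -ExZ; apply: Ex_le => // x; rewrite -RexpD.
  case: (boolP (_ <= t)) => [ht|_]; last by rewrite ltW ?Rexp_gt0.
  apply: le_trans (Rexp_ge1D _); rewrite (_ : true%:R = 1) // lerDl mulNr -mulrBr.
  by rewrite mulr_ge0 // subr_ge0.
rewrite -RexpX -RexpD; apply: Rexp_le.
have -> : lam * t = q * K%:R / 8.
  by rewrite /lam /t; field; rewrite !gt_eqF.
(* The summand 1 in the exponent absorbs the rounding of K/2. *)
rewrite -mulr_natl; nra.
Qed.

End Cube.

(** * Slices of the cube *)

Section Slices.
Variable n : nat.
Implicit Types (x y : {ffun 'I_n -> bool}) (p q : RR).

Definition weight x : nat := #|[set j | x j]|.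
Definition ham x y : nat := #|[set j | x j != y j]|.
Definition permute (t : {perm 'I_n}) x : {ffun 'I_n -> bool} := [ffun j => x (t j)].

Lemma weight_le x : (weight x <= n)%N.
Proof. by rewrite -[X in (_ <= X)%N]card_ord max_card. Qed.

Lemma prod_weight (a b : RR) x :
  \prod_j (if x j then a else b) = a ^+ weight x * b ^+ (n - weight x).
Proof.
rewrite (bigID (fun j => x j)) /=; congr (_ * _).
  rewrite (eq_bigr (fun _ => a)) => [|j ->//].
  by rewrite prodr_const; congr (_ ^+ _); apply: eq_card => j; rewrite inE.
rewrite (eq_bigr (fun _ => b)) => [|j /negbTE->//].
rewrite prodr_const; congr (_ ^+ _).
have := cardsC [set j | x j]; rewrite card_ord -/(weight x) => e.
rewrite -[X in (X - _)%N]e addKn.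
by apply: eq_card => j; rewrite !inE.
Qed.

Lemma coordsum_weight x : coordsum x = 2 * (weight x)%:R - n%:R.
Proof.
have -> : (weight x)%:R = \sum_j (x j)%:R :> RR.
  rewrite /weight -sum1_card natr_sum [RHS]big_mkcond /= [LHS]big_mkcond /=.
  by apply: eq_bigr => j _; rewrite inE; case: (x j).
have -> : n%:R = \sum_(j < n) 1 :> RR by rewrite sumr_const card_ord.
rewrite mulr_sumr -sumrB; apply: eq_bigr => j _; rewrite /sgn.
by case: (x j) => /=; ring.
Qed.

Lemma weight_permute t x : weight (permute t x) = weight x.
Proof.
rewrite /weight -[RHS](card_preimset _ (@perm_inj _ t)).
by apply: eq_card => j; rewrite !inE ffunE.
Qed.

Lemma ham_permute t x y : ham (permute t x) (permute t y) = ham x y.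
Proof.
rewrite /ham -[RHS](card_preimset _ (@perm_inj _ t)).
by apply: eq_card => j; rewrite !inE !ffunE.
Qed.

Lemma permuteM s t x : permute s (permute t x) = permute (s * t)%g x.
Proof. by apply/ffunP => j; rewrite !ffunE permM. Qed.

Lemma hamC x y : ham x y = ham y x.
Proof. by apply: eq_card => j; rewrite !inE eq_sym. Qed.

(** List each set before its complement and match the two lists by position. *)
Lemma exists_perm_subset (A B : {set 'I_n}) : (#|A| <= #|B|)%N ->
  exists t : {perm 'I_n}, forall j, j \in A -> t j \in B.
Proof.
move=> AB; case: n A B AB => [|n'] A B AB.
  by exists 1%g => -[].
pose l (S : {set 'I_n'.+1}) := enum S ++ enum (~: S).
have ml S j : j \in l S by rewrite mem_cat !mem_enum inE orbN.
have ul S : uniq (l S).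
  rewrite cat_uniq !enum_uniq andbT /=; apply/hasPn => j.
  by rewrite !mem_enum inE.
have sl S : size (l S) = n'.+1 by rewrite size_cat -!cardE cardsC card_ord.
pose f j := nth ord0 (l B) (index j (l A)).
have ix j : (index j (l A) < n'.+1)%N by rewrite -[X in (_ < X)%N](sl A) index_mem ml.
have f_inj : injective f.
  move=> i j /eqP; rewrite nth_uniq ?sl ?ul // => /eqP e.
  by rewrite -(nth_index ord0 (ml A i)) e nth_index ?ml.
exists (perm f_inj) => j jA; rewrite permE /f nth_cat.
have jlt : (index j (l A) < #|B|)%N.
  by rewrite index_cat mem_enum jA (leq_trans _ AB) // cardE index_mem mem_enum.
by rewrite -cardE jlt -mem_enum mem_nth // -cardE.
Qed.

(** One of the truncated differences is 0, so the right side is the absolute difference of the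
    weights. It is attained by nesting the smaller support inside the larger one. *)
Lemma exists_permute_ham x y : exists t,
  ham (permute t x) y = ((weight x - weight y) + (weight y - weight x))%N.
Proof.
suff h x' y' : (weight x' <= weight y')%N ->
    exists t, ham (permute t x') y' = (weight y' - weight x')%N.
  have [xy|/ltnW yx] := leqP (weight x) (weight y).
    by have [t e] := h _ _ xy; exists t; rewrite e; move/eqP: xy => ->.
  have [t e] := h _ _ yx; exists (t^-1)%g.
  rewrite -(ham_permute t) permuteM mulgV (_ : permute 1%g x = x); last first.
    by apply/ffunP => j; rewrite ffunE perm1.
  by rewrite hamC e; move/eqP: yx => ->; rewrite addn0.
move=> xy; have [t ht] := exists_perm_subset xy.
exists (t^-1)%g; set x1 := permute _ x'.
have sub : [set j | x1 j] \subset [set j | y' j].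
  apply/fintype.subsetP => j; rewrite !inE ffunE => hj.
  by have := ht ((t^-1)%g j); rewrite !inE hj permKV => ->.
rewrite -(weight_permute (t^-1)%g x') -/x1 /weight -cardsDS //.
apply: eq_card => j; rewrite !inE; move/fintype.subsetP/(_ j): sub; rewrite !inE.
by case: (x1 j); case: (y' j) => // /(_ isT).
Qed.

(* Averaging over coordinate permutations makes the test function depend on the
   weight only, so no explicit coupling of the two laws is needed. *)
Lemma invariant_mean_le (w w' : {ffun 'I_n -> bool} -> RR) (phi : {ffun 'I_n -> bool} -> RR) t b :
  prob w -> prob w' ->
  (forall s x, w (permute s x) = w x) -> (forall s x, w' (permute s x) = w' x) ->
  (forall x y, phi x <= phi y + t + b * (ham x y)%:R) ->
  \sum_x w x * phi x - \sum_x w' x * phi x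
    <= t + b * \sum_x \sum_y w x * w' y * `|(weight x)%:R - (weight y)%:R|.
Proof.
move=> hw hw' iw iw' hphi.
pose N := #|{perm 'I_n}|%:R : RR.
have N0 : 0 < N by rewrite ltr0n; apply/card_gt0P; exists 1%g.
pose Phi x := N^-1 * \sum_(s : {perm 'I_n}) phi (permute s x).
have avg v : (forall s x, v (permute s x) = v x) ->
    \sum_x v x * phi x = \sum_x v x * Phi x.
  move=> iv; have h s : \sum_x v x * phi (permute s x) = \sum_x v x * phi x.
    rewrite [RHS](reindex_inj (h := permute s)); first by apply: eq_bigr => x _; rewrite iv.
    move=> x y /(congr1 (permute s^-1)%g); rewrite !permuteM mulVg.
    by move/ffunP => e; apply/ffunP => j; have := e j; rewrite !ffunE perm1.
  rewrite /Phi; under [RHS]eq_bigr => x _ do rewrite mulrCA mulr_sumr.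
  rewrite -mulr_sumr exchange_big /=; under [in RHS]eq_bigr => s _ do rewrite h.
  rewrite sumr_const -[in RHS]mulr_natl -/N mulrA mulVf ?mul1r // gt_eqF //.
(* The average over all permutations absorbs [s0], which brings [x] as close to [y] as the weights
   allow. *)
have hPhi x y : Phi x <= Phi y + (t + b * `|(weight x)%:R - (weight y)%:R|).
  have [s0 e0] := exists_permute_ham x y.
  have -> : Phi x = N^-1 * \sum_(s : {perm 'I_n}) phi (permute s (permute s0 x)).
    congr (_ * _); rewrite [LHS](reindex_inj (mulIg s0)).
    by apply: eq_bigr => s _; rewrite permuteM.
  have -> : `|(weight x)%:R - (weight y)%:R| = (ham (permute s0 x) y)%:R :> RR.
    rewrite e0; have [xy|/ltnW yx] := leqP (weight x) (weight y).
      rewrite distrC ger0_norm ?subr_ge0 ?ler_nat // -natrB //; congr (_%:R).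
      by move/eqP: xy => ->.
    rewrite ger0_norm ?subr_ge0 ?ler_nat // -natrB //; congr (_%:R).
    by move/eqP: yx => ->; rewrite addn0.
  set d := t + _; have -> : Phi y + d = N^-1 * \sum_(s : {perm 'I_n}) (phi (permute s y) + d).
    rewrite big_split /= sumr_const -mulr_natl -/N mulrDr mulrA mulVf ?mul1r //.
    by rewrite gt_eqF.
  rewrite ler_pM2l ?invr_gt0 //; apply: ler_sum => s _; rewrite /d addrA.
  by rewrite -(ham_permute s).
rewrite (avg w) // (avg w') //.
have [[w0 w1] [w0' w1']] := (hw, hw').
have -> : \sum_x w x * Phi x - \sum_x w' x * Phi x
        = \sum_x \sum_y w x * w' y * (Phi x - Phi y).
  under [RHS]eq_bigr => x _.
    under eq_bigr => y _ do rewrite mulrBr.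
    rewrite sumrB -mulr_suml -mulr_sumr w1' mulr1.
    under [X in _ - X]eq_bigr => y _ do rewrite -mulrA.
    rewrite -mulr_sumr; over.
  by rewrite sumrB -mulr_suml w1 mul1r.
have -> : t + b * (\sum_x \sum_y w x * w' y * `|(weight x)%:R - (weight y)%:R|)
  = \sum_x \sum_y w x * w' y * (t + b * `|(weight x)%:R - (weight y)%:R|).
  under [RHS]eq_bigr => x _.
    under eq_bigr => y _ do rewrite mulrDr mulrCA.
    rewrite big_split /= -mulr_suml -mulr_sumr w1' mulr1 -mulr_sumr; over.
  by rewrite big_split /= -mulr_suml w1 mul1r -mulr_sumr.
apply: ler_sum => x _; apply: ler_sum => y _; apply: ler_wpM2l; first exact: mulr_ge0.
by rewrite lerBlDl.
Qed.

Lemma pw_bw p x : pw (bw p) x = p ^+ weight x * (1 - p) ^+ (n - weight x).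
Proof. by rewrite -prod_weight. Qed.

Lemma variance_bw p : 0 <= p <= 1 ->
  Ex (bw p) (fun x => ((weight x)%:R - n%:R * p) ^+ 2) = n%:R * (p * (1 - p)).
Proof.
move=> hp01; have hp := prob_bw hp01.
have key r : uniq r -> Ex (bw p) (fun x => (\sum_(j <- r) ((x j)%:R - p)) ^+ 2)
           = (size r)%:R * (p * (1 - p)).
  elim: r => [|i r IH] /=.
    move=> _; rewrite mul0r /Ex big1 // => x _; by rewrite big_nil expr0n mulr0.
  move=> /andP[ir ur]; rewrite -natr1 mulrDl mul1r -IH // -(Ex_E1 i _ hp.2).
  rewrite -[X in _ = _ + X](@Ex_const 'I_n bool (bw p) _ hp) -ExD.
  apply: eq_bigr => x _; congr (_ * _); rewrite /E1 big_bool /=.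
  have e b : \sum_(j <- r) ((upd x i b j)%:R - p) = \sum_(j <- r) ((x j)%:R - p).
    apply: eq_big_seq => j jr; rewrite ffunE; case: eqP => // ji.
    by rewrite -ji jr in ir.
  rewrite !big_cons !e !upd_at /=; set S := \sum_(j <- r) _; ring.
rewrite -[in RHS](size_enum_ord n) -key ?enum_uniq //.
apply: eq_bigr => x _; congr (_ * _ ^+ 2); rewrite big_enum /= sumrB.
rewrite sumr_const card_ord mulr_natl; congr (_ - _).
rewrite /weight -sum1_card natr_sum [RHS]big_mkcond /= [LHS]big_mkcond /=.
by apply: eq_bigr => j _; rewrite inE; case: (x j).
Qed.

Lemma mean_dev_bw p : (0 < n)%N -> 0 <= p <= 1 ->
  Ex (bw p) (fun x => `|(weight x)%:R - n%:R * p|) <= Num.sqrt n%:R.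
Proof.
move=> n0 hp01; have hp := prob_bw hp01; set sq := Num.sqrt _.
have sq0 : 0 < sq by rewrite sqrtr_gt0 ltr0n.
have sqE : sq ^+ 2 = n%:R by rewrite sqr_sqrtr.
(* The bound |u| <= sq/2 + u^2/(2 sq) reduces the mean deviation to the variance. *)
apply: (@le_trans _ _ (Ex (bw p) (fun x => sq / 2 + (2 * sq)^-1 * ((weight x)%:R - n%:R * p) ^+ 2))).
  apply: Ex_le => // x; set u := _ - _; rewrite -(ler_pM2l (_ : 0 < 2 * sq)) ?mulr_gt0 //.
  have -> : 2 * sq * (sq / 2 + (2 * sq)^-1 * u ^+ 2) = sq ^+ 2 + u ^+ 2.
    by field; rewrite gt_eqF.
  have := sqr_ge0 (sq - `|u|); rewrite sqrrB real_normK ?num_real //; lra.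
rewrite ExD Ex_const // ExZ variance_bw // -sqE.
have hpq : p * (1 - p) <= 1 by nra.
have -> : (2 * sq)^-1 * (sq ^+ 2 * (p * (1 - p))) = sq / 2 * (p * (1 - p)).
  by field; rewrite gt_eqF.
by nra.
Qed.

End Slices.

(** * Near-modes of the binomial law *)

Section BinomialMode.
Variables (n : nat) (p : RR).
Hypothesis p01 : 0 < p < 1.

Definition bin_mass (l : nat) := 'C(n, l)%:R * (p ^+ l * (1 - p) ^+ (n - l)).
Local Notation r := bin_mass.

Lemma bin_mass_ge0 l : 0 <= r l.
Proof.
case/andP: p01 => p0 p1.
by rewrite mulr_ge0 ?ler0n // mulr_ge0 ?exprn_ge0 //; lra.
Qed.

Lemma bin_mass_sum : \sum_(l < n.+1) r l = 1.
Proof.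
have := exprDn (1 - p) p n; rewrite subrK expr1n => ->.
by apply: eq_bigr => l _; rewrite -mulr_natl /bin_mass [p ^+ _ * _]mulrC.
Qed.

Lemma bin_mass_rec l : (l < n)%N ->
  l.+1%:R * (1 - p) * r l.+1 = (n%:R - l%:R) * p * r l.
Proof.
move=> ln; rewrite -natrB ?(ltnW ln) //.
have e : l.+1%:R * 'C(n, l.+1)%:R = (n - l)%:R * 'C(n, l)%:R :> RR.
  by rewrite -!natrM mul_bin_left.
rewrite /bin_mass -(subnSK ln) !exprS.
transitivity (l.+1%:R * 'C(n, l.+1)%:R * (p * p ^+ l * (1 - p) * (1 - p) ^+ (n - l.+1))); first by ring.
by rewrite e -(subnSK ln); ring.
Qed.

Lemma bin_mass_up d l : (l + d <= n)%N -> (l + d)%:R <= n%:R * p -> r l <= r (l + d).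
Proof.
case/andP: p01 => p0 p1; elim: d => [|d IH]; first by rewrite addn0.
rewrite addnS => ld; rewrite -natr1 => h.
apply: (@le_trans _ _ (r (l + d))); first by apply: IH; [exact: ltnW | lra].
have c0 : 0 < (l + d).+1%:R * (1 - p) by rewrite mulr_gt0 ?ltr0n //; lra.
rewrite -(ler_pM2l c0) bin_mass_rec //; apply: ler_wpM2r; first exact: bin_mass_ge0.
by rewrite -natr1; nra.
Qed.

Lemma bin_mass_down d l : (l + d <= n)%N -> n%:R * p <= l%:R -> r (l + d) <= r l.
Proof.
case/andP: p01 => p0 p1; elim: d => [|d IH]; first by rewrite addn0.
rewrite addnS => ld h.
apply: (@le_trans _ _ (r (l + d))); last by apply: IH; first exact: ltnW.
have c0 : 0 < (l + d).+1%:R * (1 - p) by rewrite mulr_gt0 ?ltr0n //; lra.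
rewrite -(ler_pM2l c0) bin_mass_rec //; apply: ler_wpM2r; first exact: bin_mass_ge0.
have : l%:R <= (l + d)%:R :> RR by rewrite ler_nat leq_addr.
by rewrite -natr1; nra.
Qed.

(** The masses increase up to the mean n p and decrease after it. Only when [k] and [l] lie on
    opposite sides must the mean be crossed, and that single step costs at most a factor 2. *)
Lemma bin_mass_mode k l : (k <= n)%N -> (l <= n)%N ->
  k%:R = n%:R * p - 2^-1 \/ k%:R = n%:R * p + 2^-1 -> r l <= 2 * r k.
Proof.
case/andP: p01 => p0 p1; move=> kn ln; have rk := bin_mass_ge0 k.
have rk2 : r k <= 2 * r k by lra.
have [lk|kl] := leqP l k; case=> hk.
- apply: le_trans rk2; rewrite -(subnKC lk); apply: bin_mass_up; rewrite subnKC //.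
  by rewrite hk; lra.
- move: lk; rewrite leq_eqVlt => /orP[/eqP->//|lk].
  have k1 : (k.-1.+1 = k)%N by case: (k) lk.
  apply: (@le_trans _ _ (r k.-1)).
    rewrite -(subnKC (_ : l <= k.-1)%N); last by lia.
    apply: bin_mass_up; rewrite subnKC; [lia| lia| |lia].
    have : k.-1%:R + 1 = k%:R :> RR by rewrite natr1 k1.
    by rewrite hk; lra.
  have := @bin_mass_rec k.-1; rewrite k1 => /(_ kn).
  have e : k.-1%:R + 1 = k%:R :> RR by rewrite natr1 k1.
  have e1 : 1 <= k%:R :> RR by rewrite ler1n; lia.
  have kn' : k%:R <= n%:R :> RR by rewrite ler_nat.
  move: (bin_mass_ge0 k.-1); set a := r k.-1; set b := r k => a0 h.
  have h1 : k%:R * (1 - p) <= 2 * ((n%:R - k.-1%:R) * p) by nra.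
  have c0 : 0 < (n%:R - k.-1%:R) * p by rewrite mulr_gt0 //; lra.
  rewrite -(ler_pM2l c0) -h.
  have b0 : 0 <= b by [].
  have := ler_wpM2r b0 h1; lra.
- apply: (@le_trans _ _ (r k.+1)).
    rewrite -(subnKC kl); apply: bin_mass_down; rewrite ?subnKC //.
    by rewrite -natr1 hk; lra.
  have kn1 : (k < n)%N by lia.
  have := bin_mass_rec kn1.
  have kn' : k%:R + 1 <= n%:R :> RR by rewrite natr1 ler_nat.
  have kp := ler0n RR k.
  move: (bin_mass_ge0 k.+1); set a := r k.+1; set b := r k => a0; rewrite -natr1 => h.
  have h1 : (n%:R - k%:R) * p <= 2 * ((k%:R + 1) * (1 - p)) by nra.
  have c0 : 0 < (k%:R + 1) * (1 - p) by rewrite mulr_gt0 //; lra.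
  rewrite -(ler_pM2l c0) h.
  have b0 : 0 <= b by [].
  have := ler_wpM2r b0 h1; lra.
- apply: le_trans rk2; rewrite -(subnKC (ltnW kl)); apply: bin_mass_down.
    by rewrite subnKC // ltnW.
  by rewrite hk; lra.
Qed.

Lemma bin_mass_mode_lower k : (k <= n)%N ->
  k%:R = n%:R * p - 2^-1 \/ k%:R = n%:R * p + 2^-1 -> 1 <= 2 * n.+1%:R * r k.
Proof.
case/andP: p01 => p0 p1; move=> kn hk; rewrite -[X in X <= _]bin_mass_sum.
apply: (@le_trans _ _ (\sum_(l < n.+1) 2 * r k)).
  by apply: ler_sum => l _; apply: bin_mass_mode => //; rewrite -ltnS.
by rewrite sumr_const card_ord -[X in X <= _]mulr_natl mulrA [_ * 2]mulrC.
Qed.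

End BinomialMode.

(** * Comparison of the slice law with the Bernoulli law *)

Section SliceLaw.
Variables (n : nat) (s : int).
Hypotheses (n0 : (0 < n)%N) (S0 : (0 < #|Sset n s|)%N).
Local Notation p := (pplus n s).
Implicit Types (x y : {ffun 'I_n -> bool}).

(** The definition is read with the Stdlib operations on the reals; this form uses the ring
    operations. *)
Lemma pplusE : p = 2^-1 + s%:~R / (2 * n%:R).
Proof. by rewrite /pplus RplusE RdivE RmultE. Qed.

Lemma mul_pplus : n%:R * p = (n%:R + s%:~R) / 2.
Proof. by rewrite pplusE; field; rewrite pnatr_eq0 -lt0n. Qed.

Lemma wB_bw x : wB s x = pw (bw p) x.
Proof. by []. Qed.

Lemma weight_Sset x : x \in Sset n s ->
  (weight x)%:R = n%:R * p - 2^-1 \/ (weight x)%:R = n%:R * p + 2^-1.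
Proof.
by rewrite inE coordsum_weight mul_pplus => /orP[/eqP h|/eqP h]; [left|right]; lra.
Qed.

Lemma prob_wS : prob (@wS n s).
Proof.
split=> [x|]; first by rewrite /wS; case: ifP => // _; rewrite invr_ge0 ler0n.
rewrite /wS -big_mkcond /= sumr_const -[LHS]mulr_natl mulfV //.
by rewrite pnatr_eq0 -lt0n.
Qed.

Lemma wS_permute t x : wS s (permute t x) = wS s x.
Proof. by rewrite /wS !inE !coordsum_weight weight_permute. Qed.

Lemma wB_permute t x : wB s (permute t x) = wB s x.
Proof. by rewrite !wB_bw !pw_bw weight_permute. Qed.

Lemma wS_gt0 x : 0 < wS s x -> x \in Sset n s.
Proof. by rewrite /wS; case: ifP => //; rewrite ltxx. Qed.

Lemma card_Sset_ge x : x \in Sset n s -> ('C(n, weight x) <= #|Sset n s|)%N.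
Proof.
move=> xS; pose g (A : {set 'I_n}) : {ffun 'I_n -> bool} := [ffun j => j \in A].
have g_inj : injective g.
  by move=> A B /ffunP e; apply/setP => j; have := e j; rewrite !ffunE.
rewrite -[n in 'C(n, _)]card_ord -card_draws -(card_imset _ g_inj).
apply: subset_leq_card; apply/fintype.subsetP => y /imsetP[A].
rewrite inE => /eqP cA ->; move: xS; rewrite !inE !coordsum_weight.
suff -> : weight (g A) = weight x by [].
by rewrite -cA; apply: eq_card => j; rewrite inE ffunE.
Qed.

(** The slice contains the whole level of [x], so its mass at [x] is at most 1/C(n, weight x); that
    level lies within 1/2 of the mean and has Bernoulli mass at least 1/(2(n+1)). *)
Lemma wS_le_wB x : 0 < p < 1 -> wS s x <= 2 * n.+1%:R * wB s x.
Proof.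
move=> p01; have [p0 p1] := andP p01; rewrite wB_bw pw_bw /wS.
have pwx : 0 <= p ^+ weight x * (1 - p) ^+ (n - weight x).
  by rewrite mulr_ge0 // exprn_ge0 //; lra.
case: ifPn => xS; last by rewrite mulr_ge0 // mulr_ge0 ?ler0n.
have C0 : 0 < 'C(n, weight x)%:R :> RR by rewrite ltr0n bin_gt0 weight_le.
apply: (@le_trans _ _ ('C(n, weight x)%:R)^-1).
  by rewrite lef_pV2 ?ler_nat ?card_Sset_ge // !posrE ?ltr0n.
rewrite -(ler_pM2l C0) mulfV ?gt_eqF //.
have := bin_mass_mode_lower p01 (weight_le x) (weight_Sset xS).
by rewrite /bin_mass; lra.
Qed.

(** Slice weights lie within 1/2 of n p, and Bernoulli weights deviate from n p by at most sqrt n on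
    average; 1/2 + sqrt n <= 2 sqrt n. *)
Lemma slice_mean_le phi t b : 0 <= p <= 1 -> 0 <= b ->
  (forall x y, phi x <= phi y + t + b * (ham x y)%:R) ->
  `|\sum_x wS s x * phi x - \sum_x wB s x * phi x| <= t + b * (2 * Num.sqrt n%:R).
Proof.
move=> p01 b0 hphi; have hp := prob_bw p01.
have hB : prob (@wB n s) by apply: (prob_pw _ hp).
have hS := prob_wS.
have sq1 : 1 <= Num.sqrt n%:R :> RR by rewrite -[X in X <= _]sqrtr1 ler_wsqrtr // ler1n.
have key : \sum_x \sum_y @wS n s x * @wB n s y * `|(weight x)%:R - (weight y)%:R| <= 2 * Num.sqrt n%:R.
  have h1 : \sum_x \sum_y @wS n s x * @wB n s y * `|(weight x)%:R - (weight y)%:R|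
      <= \sum_x @wS n s x * (2^-1 + Num.sqrt n%:R).
    apply: ler_sum => x _; under eq_bigr => y _ do rewrite -mulrA.
    rewrite -mulr_sumr; have [w0|w0] := ltrP 0 (wS s x); last first.
      have -> : wS s x = 0 by apply/eqP; rewrite eq_le w0 hS.1.
      by rewrite !mul0r.
    rewrite ler_pM2l //.
    apply: (@le_trans _ _ (\sum_y @wB n s y * (2^-1 + `|(weight y)%:R - n%:R * p|))).
      apply: ler_sum => y _; apply: ler_wpM2l; first exact: hB.1.
      have hx : `|(weight x)%:R - n%:R * p| <= 2^-1.
        by case: (weight_Sset (wS_gt0 w0)) => ->; rewrite ler_norml; apply/andP; split; lra.
      have -> : (weight x)%:R - (weight y)%:R
          = ((weight x)%:R - n%:R * p) - ((weight y)%:R - n%:R * p) :> RR by ring.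
      by apply: le_trans (ler_normB _ _) _; rewrite lerD2r.
    under eq_bigr => y _ do rewrite mulrDr.
    rewrite big_split /= -mulr_suml hB.2 mul1r lerD2l.
    exact: mean_dev_bw.
  apply: le_trans h1 _; rewrite -mulr_suml hS.2 mul1r.
  by move: (Num.sqrt _) sq1 => sq sq1; lra.
rewrite ler_norml; apply/andP; split.
  rewrite -lerN2 opprK opprB; apply: le_trans (invariant_mean_le hB hS wB_permute wS_permute hphi) _.
  rewrite lerD2l ler_wpM2l // exchange_big /=; apply: le_trans key.
  apply: ler_sum => x _; apply: ler_sum => y _.
  by rewrite distrC [wB s y * _]mulrC.
apply: le_trans (invariant_mean_le hS hB wS_permute wB_permute hphi) _.
by rewrite lerD2l ler_wpM2l.
Qed.

End SliceLaw.

(** * Log-determinant and distances *)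

Section SpanDistance.
Variable R : rcfType.
Local Notation C := R[i].

(** Each side is the minimal squared distance to the same span; by symmetry the two are equal. *)
Lemma span_proj_uniq n (U : 'M[C]_n) S P M P' M' u :
  span_proj U S P M -> span_proj U S P' M' -> nrm2 (u *m P) <= nrm2 (u *m P').
Proof.
move=> h h'; rewrite (span_proj_decomp h' u); apply: (span_proj_min h).
exact: (span_proj_supp h').
Qed.

Lemma span_proj_eq_rows n (U U' : 'M[C]_n) (S : {set 'I_n}) P M :
  (forall j, j \in S -> row j U = row j U') -> span_proj U S P M -> span_proj U' S P M.
Proof.
move=> UU' [oP kP tP eP mP]; split=> //; first by move=> j jS; rewrite -UU' // kP.
rewrite eP; apply/matrixP=> i k; rewrite !mxE; apply: eq_bigr => j _.
have [jS|jS] := boolP (j \in S); last by rewrite mP // !mul0r.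
by have /rowP/(_ k) := UU' _ jS; rewrite !mxE => ->.
Qed.

End SpanDistance.

Section LogDet.
Arguments Rpower.ln _ : clear scopes.
Local Notation ln := Rpower.ln.
Local Notation C := RR[i].
Variable n : nat.
Implicit Types (U : 'M[C]_n).

Definition lt_set (m : nat) : {set 'I_n} := [set j : 'I_n | (j < m)%N].

Lemma lt_setS (i : 'I_n) : lt_set i.+1 = i |: lt_set i.
Proof. by apply/setP => j; rewrite !inE ltnS leq_eqVlt. Qed.

Lemma lt_set_notin (i : 'I_n) : i \notin lt_set i.
Proof. by rewrite inE ltnn. Qed.

Lemma card_lt_set_le m : (#|lt_set m| <= m)%N.
Proof.
pose f (j : 'I_n) : 'I_m.+1 := inord j.
have f_inj : {in lt_set m &, injective f}.
  move=> j k; rewrite !inE => jm km /(congr1 val).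
  by rewrite /= !inordK ?(leq_trans _ (leqnSn m)) // => /val_inj.
have sub : f @: lt_set m \subset [set~ ord_max].
  apply/fintype.subsetP => k /imsetP[j]; rewrite !inE => jm ->.
  by rewrite -val_eqE /= inordK ?ltn_eqF // (leq_trans jm).
rewrite -(card_in_imset f_inj); apply: leq_trans (subset_leq_card sub) _.
by rewrite cardsC1 card_ord.
Qed.

Lemma sum1_lt m : (m <= n)%N -> \sum_(i < n | (i < m)%N) (1 : RR) = m%:R.
Proof.
move=> mn; transitivity (\sum_(i < m) (1 : RR)); last by rewrite sumr_const card_ord.
exact: esym (big_ord_widen n (fun _ => 1) mn).
Qed.

Lemma detr_prod a U m : 0 < a -> (m <= n)%N ->
  detr a U (lt_set m)
  = a ^+ n * \prod_(i < n | (i < m)%N) (1 + rq (regmx a U (lt_set i)) (row i U)).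
Proof.
move=> a0; elim: m => [|m IH] mn.
  have -> : lt_set 0 = finset.set0 by apply/setP => j; rewrite !inE.
  by rewrite detr0 big_pred0_eq mulr1.
pose i := Ordinal mn; rewrite -[m]/(val i) (lt_setS i) detr_U1 ?lt_set_notin //.
rewrite IH ?(ltnW mn) // (bigD1 (P := fun j : 'I_n => (j < i.+1)%N) i) //=.
rewrite [in RHS]mulrA [in RHS]mulrAC; congr (_ * _ * _).
by apply: eq_bigl => j; rewrite ltnS ltn_neqAle andbC.
Qed.

(* The last m - m' rows are estimated one by one, the first m' together by [sum_gs_coef]. *)
Lemma logdet_compare a B beta del (m m' : nat) U (P M : 'I_n -> 'M[C]_n) :
  0 < a -> 0 < beta -> 0 < del -> beta <= a + B ->
  (m' <= m)%N -> (m <= n)%N ->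
  (forall i : 'I_n, span_proj U (lt_set i) (P i) (M i)) ->
  (forall i, nrm2 (row i U) <= B) ->
  (forall i : 'I_n, (i < m)%N -> beta <= nrm2 (row i U *m P i)) ->
  (forall (j : 'I_n) Q N, (j < m')%N -> span_proj U (lt_set m' :\ j) Q N ->
     del <= nrm2 (row j U *m Q)) ->
  0 <= ln (detr a U (lt_set m)) - (n%:R - m%:R) * ln a
       - \sum_(i < n | (i < m)%N) ln (nrm2 (row i U *m P i))
    <= a * n%:R / del + (m%:R - m'%:R) * ln ((a + B) / beta).
Proof.
move=> a0 b0 d0 bB m'm mn spP hB hbeta hdel.
pose Q (i : 'I_n) := rq (regmx a U (lt_set i)) (row i U).
pose D (i : 'I_n) := nrm2 (row i U *m P i).
have D0 (i : 'I_n) : (i < m)%N -> 0 < D i by move=> /hbeta; apply: lt_le_trans.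
have Q0 (i : 'I_n) : 0 <= Q i by apply: rq_ge0; rewrite // regmx_unit.
have card_m : \sum_(i < n | (i < m)%N) (1 : RR) = m%:R.
  exact: sum1_lt.
have card_m' : \sum_(i < n | (i < m')%N) (1 : RR) = m'%:R.
  exact/sum1_lt/(leq_trans m'm).
(* The powers of [a] are redistributed: one factor [a] goes to each of the first [m] rows, and the
   other n - m cancel with the subtracted term. *)
have eG : ln (detr a U (lt_set m)) - (n%:R - m%:R) * ln a - \sum_(i < n | (i < m)%N) ln (D i)
    = \sum_(i < n | (i < m)%N) ln ((a + a * Q i) / D i).
  have -> : ln (detr a U (lt_set m)) = n%:R * ln a + \sum_(i < n | (i < m)%N) ln (1 + Q i).
    have Q1 (i : 'I_n) : (i < m)%N -> 0 < 1 + Q i by move=> _; rewrite ltr_pwDl.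
    by rewrite detr_prod // RlnM ?exprn_gt0 ?prodr_gt0 // RlnX // Rln_prod.
  have -> : (n%:R - m%:R) * ln a = n%:R * ln a - \sum_(i < n | (i < m)%N) ln a.
    rewrite mulrBl -card_m mulr_suml; congr (_ - _).
    by apply: eq_bigr => i _; rewrite mul1r.
  have -> : \sum_(i < n | (i < m)%N) ln ((a + a * Q i) / D i)
     = \sum_(i < n | (i < m)%N) (ln (1 + Q i) + ln a - ln (D i)).
    apply: eq_bigr => i im; have Di := D0 _ im.
    have e : a + a * Q i = (a + a * Q i) / D i * D i by rewrite divfK // gt_eqF.
    have aQ : 0 < a + a * Q i by rewrite ltr_pwDl // mulr_ge0 // ltW.
    have : ln (a + a * Q i) = ln ((a + a * Q i) / D i) + ln (D i).
      by rewrite {1}e RlnM // divr_gt0.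
    have -> : a + a * Q i = (1 + Q i) * a by ring.
    rewrite RlnM ?ltr_pwDl // => ->; ring.
  rewrite sumrB big_split /=; ring.
rewrite eG; apply/andP; split.
  apply: sumr_ge0 => i im; apply: Rln_ge0; rewrite ler_pdivlMr ?D0 // mul1r.
  have [oP kP _ _ _] := spP i.
  have := rq_proj_le a0 (regmx_unit a0 U (lt_set i)) (row i U) oP kP.
  by rewrite -/(Q i) -/(D i); lra.
rewrite (bigID (fun i : 'I_n => (i < m')%N)) /=; apply: lerD; last first.
  apply: (@le_trans _ _ (\sum_(i < n | (i < m)%N && ~~ (i < m')%N) ln ((a + B) / beta))).
    apply: ler_sum => i /andP[im _]; apply: Rln_le.
      by rewrite divr_gt0 ?D0 // ltr_pwDl // mulr_ge0 // ltW.
    apply: ler_pM; rewrite ?invr_ge0 ?(ltW (D0 _ im)) //.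
    - by rewrite addr_ge0 ?mulr_ge0 // ltW.
    - rewrite lerD2l; apply: le_trans (hB i); apply: rq_le => //; exact: regmx_unit.
    - by rewrite lef_pV2 ?posrE ?D0 // hbeta.
  rewrite le_eqVlt; apply/orP; left; apply/eqP.
  have := card_m; rewrite (bigID (fun i : 'I_n => (i < m')%N)) /= => h.
  have e : \sum_(i < n | (i < m)%N && (i < m')%N) (1 : RR) = m'%:R.
    rewrite -card_m'; apply: eq_bigl => i; apply: andb_idl => im'; exact: leq_trans m'm.
  rewrite e in h; have -> : m%:R - m'%:R = \sum_(i < n | (i < m)%N && ~~ (i < m')%N) (1 : RR).
    by apply/eqP; rewrite subr_eq -h addrC.
  by rewrite mulr_suml; apply: eq_bigr => i _; rewrite mul1r.
have D0' (i : 'I_n) : (i < m')%N -> 0 < D i by move=> im; apply/D0/(leq_trans im).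
have hsum := @sum_gs_coef _ n U P M m' spP D0' del d0.
(* For these rows the ratio is at most 1 + a |g_i|^2 / D_i by [ridge_gs], and ln (1 + x) <= x. *)
apply: (@le_trans _ _ (a * \sum_(i < n | (i < m')%N) nrm2 (gs_coef U M i) / D i)).
  rewrite mulr_sumr [X in X <= _](_ : _ = \sum_(i < n | (i < m')%N) ln ((a + a * Q i) / D i)).
    apply: ler_sum => i im; have Di := D0' _ im.
    have h := ridge_gs spP i a0; rewrite -/(Q i) -/(D i) in h.
    have x0 : 0 <= a * (nrm2 (gs_coef U M i) / D i).
      by rewrite mulr_ge0 ?divr_ge0 ?nrm2_ge0 // ltW.
    apply: le_trans (Rln1D_le x0); apply: Rln_le.
      by rewrite divr_gt0 // ltr_pwDl // mulr_ge0 // ltW.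
    by rewrite ler_pdivrMr // mulrDl mul1r mulrA divfK // gt_eqF.
  by apply: eq_bigl => i; apply: andb_idl => im'; exact: leq_trans m'm.
rewrite -mulrA ler_pM2l //; apply: hsum => j c jm cS.
have [Pj [Mj sp]] := exists_span_proj U (lt_set m' :\ j).
apply: le_trans (hdel _ _ _ jm sp) _; apply: (span_proj_min sp) => k kS.
by apply: cS; move: kS; rewrite !inE andbC.
Qed.

End LogDet.

(** * Random rows *)

Section RandomRows.
Arguments Rtrigo_def.exp _ : clear scopes.
Arguments Rpower.ln _ : clear scopes.
Local Notation exp := Rtrigo_def.exp.
Local Notation ln := Rpower.ln.
Local Notation C := RR[i].
Variables (n : nat) (s : int) (z : C) (v : {ffun 'I_n -> bool}).
Implicit Types (X : rowsT n) (x y : {ffun 'I_n -> bool}) (i j : 'I_n) (S : {set 'I_n}).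

Definition rowM X : 'M[C]_n := \matrix_(i, j) rowC z v X i j.

Definition shift i : 'rV[C]_n :=
  \row_j (((sgn (v j))%:C)%C + (if j == i then z * ((Num.sqrt (n%:R : RR))%:C)%C else 0)).

Lemma row_rowM X i : row i (rowM X) = xrow (X i) + shift i.
Proof. by apply/rowP=> j; rewrite !mxE /rowC rmorphD addrA. Qed.

Lemma row_rowM_upd X i y : row i (rowM (upd X i y)) = xrow y + shift i.
Proof. by rewrite row_rowM upd_at. Qed.

Lemma row_rowM_other X i j y : j != i -> row j (rowM (upd X i y)) = row j (rowM X).
Proof. by move=> ji; rewrite !row_rowM ffunE (negbTE ji). Qed.

Definition row_bound := (8 + 2 * sqn z) * n%:R.

Lemma nrm2_row_le X i : nrm2 (row i (rowM X)) <= row_bound.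
Proof.
rewrite nrm2E /row_bound.
apply: (@le_trans _ _ (\sum_(j < n) (8 + (j == i)%:R * (2 * sqn z * n%:R)))).
  apply: ler_sum => j _; rewrite !mxE; apply: le_trans (sqnD_le _ _) _.
  have h1 : sqn ((sgn (X i j) + sgn (v j))%:C)%C <= 4.
    by rewrite sqn_real /sgn; case: (X i j); case: (v j); lra.
  case: eqP => _; last by rewrite sqn0 mul0r; lra.
  by rewrite sqnM (sqn_real (Num.sqrt _)) sqr_sqrtr ?ler0n // mul1r; lra.
rewrite big_split /= sumr_const card_ord (bigD1 i) //= eqxx mul1r big1 => [|j /negbTE->].
  by rewrite addr0 -[_ *+ n]mulr_natr; lra.
by rewrite mul0r.
Qed.

(** The infimum is attained at the coefficients of the orthogonal projection. *)
Lemma dist_spanE X i P M : span_proj (rowM X) (lt_set n i) P M ->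
  dist_span (rowC z v X i) (rowC z v X) i = Num.sqrt (nrm2 (row i (rowM X) *m P)).
Proof.
move=> sp; set U := rowM X.
have cnE (w : 'I_n -> C) : cnorm w = Num.sqrt (nrm2 (\row_k w k)).
  by rewrite nrm2E; congr Num.sqrt; apply: eq_bigr => k _; rewrite mxE.
have comb (c : 'I_n -> C) :
    \row_k (rowC z v X i k - \sum_(j < n | (j < i)%N) c j * rowC z v X j k)
    = row i U - (\row_j (if (j < i)%N then c j else 0)) *m U.
  apply/rowP=> k; rewrite !mxE big_mkcond; congr (_ - _).
  by apply: eq_bigr => j _; rewrite !mxE; case: ifP => // _; rewrite mul0r.
rewrite /dist_span; set A := (X in inf X).
have lbA : lbound A (Num.sqrt (nrm2 (row i U *m P))).
  move=> _ [c ->]; rewrite cnE comb ler_wsqrtr //; apply: (span_proj_min sp) => j.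
  by rewrite inE mxE => /negbTE ->.
have inA : A (Num.sqrt (nrm2 (row i U *m P))).
  pose c := row i U *m M; exists (fun j => c 0 j).
  rewrite cnE (comb (fun j => c 0 j)) (span_proj_decomp sp (row i U)) -/c.
  suff -> : \row_j (if (j < i)%N then c 0 j else 0) = c by [].
  apply/rowP => j; rewrite mxE.
  by case: ifPn => // ji; rewrite (span_proj_supp sp) // inE.
apply/eqP; rewrite eq_le; apply/andP; split.
  by apply: ge_inf => //; exists (Num.sqrt (nrm2 (row i U *m P))).
by apply: lb_le_inf => //; exists (Num.sqrt (nrm2 (row i U *m P))).
Qed.

(** By [span_proj_uniq] the squared length does not depend on the choice of [P] and [M], so this is
    the event that row [i] has squared distance at most [th] to the span of the rows in [S]. *)
Definition near_span S (th : RR) i X : bool :=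
  `[< exists P M, span_proj (rowM X) S P M /\ nrm2 (row i (rowM X) *m P) <= th >].

Definition ldet a S X : RR := ln (detr a (rowM X) S).

Section Weight.
Variables (w : {ffun 'I_n -> bool} -> RR) (Dn q : RR).
Hypothesis hw : prob w.

(** As [i] is not in [S], resampling row [i] leaves the span fixed. With the other rows frozen,
    domination of [w] by the Bernoulli law reduces the claim to [small_ball]. *)
Lemma near_span_prob S i (K : nat) : 0 < q -> q <= pplus n s -> pplus n s <= 1 - q ->
  0 <= Dn -> (forall x, w x <= Dn * wB s x) ->
  i \notin S -> (0 < K)%N -> (K + #|S| <= n)%N ->
  Pr w (near_span S (q * K%:R ^+ 2 / (16 * n%:R))%R i) <= Dn * exp (1 - q * K%:R / 8).
Proof.
move=> q0 qp pq Dn0 wD iS K0 KS; set th := _ / (16 * n%:R).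
apply: (@Pr_coord _ _ w i) => // X.
have [P [M sp]] := exists_span_proj (rowM X) S.
have [oP _ tP _ _] := sp.
have tK : K%:R <= complex.Re (\tr P).
  apply: le_trans tP; rewrite -natrB ?ler_nat; last by apply: leq_trans KS; apply: leq_addl.
  by rewrite leq_subRL ?[(#|S| + _)%N]addnC //; apply: leq_trans KS; apply: leq_addl.
have := small_ball (shift i) q0 qp pq K0 oP tK; rewrite -/th => hb.
have := ler_wpM2l Dn0 hb; apply: le_trans.
rewrite /Pr /Ex mulr_sumr; apply: ler_sum => y _.
rewrite mulrA; apply: ler_pM; rewrite ?hw.1 ?ler0n ?wD // ler_nat.
case: (boolP (near_span _ _ _ _)) => // /asboolP[P' [M' [sp' h']]].
suff -> : nrm2 ((xrow y + shift i) *m P) <= th by [].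
apply: le_trans h'; rewrite row_rowM_upd; apply: (span_proj_uniq _ _ sp').
apply: span_proj_eq_rows sp => j jS; rewrite row_rowM_other //.
by apply: contra iS => /eqP <-.
Qed.

End Weight.

Section Lipschitz.
Variables (a : RR) (S : {set 'I_n}).
Hypothesis a0 : 0 < a.

Lemma ldet_indep X i y : i \notin S -> ldet a S (upd X i y) = ldet a S X.
Proof.
move=> iS; rewrite /ldet /detr (@eq_regmx _ _ a (rowM (upd X i y)) (rowM X)) // => j jS.
by rewrite row_rowM_other //; apply: contra iS => /eqP <-.
Qed.

Lemma ldet_upd X i y : i \in S ->
  ldet a S (upd X i y) = ldet a (S :\ i) X
    + ln (1 + rq (regmx a (rowM X) (S :\ i)) (xrow y + shift i)).
Proof.
move=> iS; rewrite /ldet -{1}(setD1K iS) detr_U1 ?inE ?eqxx //.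
have e : regmx a (rowM (upd X i y)) (S :\ i) = regmx a (rowM X) (S :\ i).
  by apply: eq_regmx => j; rewrite !inE => /andP[ji _]; rewrite row_rowM_other.
rewrite /detr e row_rowM_upd RlnM //; first exact: detr_gt0.
by rewrite ltr_pwDl // rq_ge0 // regmx_unit.
Qed.

Lemma ldet_bdiff : bdiff (ldet a S) (ln (1 + row_bound / a)).
Proof.
have B0 : 0 <= row_bound / a.
  by rewrite divr_ge0 ?(ltW a0) // mulr_ge0 ?ler0n // addr_ge0 // mulr_ge0 ?sqn_ge0.
move=> i X y y'; have [iS|iS] := boolP (i \in S); last first.
  by rewrite !ldet_indep // subrr; apply: Rln_ge0; rewrite lerDl.
rewrite !ldet_upd // opprD addrACA subrr add0r.
have q0 u : 0 <= rq (regmx a (rowM X) (S :\ i)) u by rewrite rq_ge0 // regmx_unit.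
have h1 : 0 <= ln (1 + rq (regmx a (rowM X) (S :\ i)) (xrow y' + shift i)).
  by apply: Rln_ge0; rewrite lerDl.
have h2 : ln (1 + rq (regmx a (rowM X) (S :\ i)) (xrow y + shift i)) <= ln (1 + row_bound / a).
  apply: Rln_le; first by rewrite ltr_pwDl.
  rewrite lerD2l ler_pdivlMr // mulrC; apply: le_trans (rq_le a0 (regmx_unit a0 _ _) _) _.
  by rewrite -(row_rowM_upd X); apply: nrm2_row_le.
lra.
Qed.

(** Apply [rq_add] to the row of [y] and the difference; each differing coordinate contributes 4 to
    the squared norm. Then 1 + (1 + t) Q + d <= (1 + Q)(1 + t + d), and ln (1 + t + d) <= t + d. *)
Lemma ln_rq_ham (S' : {set 'I_n}) X i t x y : 0 < t ->
  ln (1 + rq (regmx a (rowM X) S') (xrow x + shift i))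
    <= ln (1 + rq (regmx a (rowM X) S') (xrow y + shift i)) + t
       + (1 + t^-1) * (4 / a) * (ham x y)%:R.
Proof.
move=> t0; have Au := regmx_unit a0 (rowM X) S'.
set Q := rq (regmx a (rowM X) S').
have Q0 u : 0 <= Q u by apply: rq_ge0.
have tV : 0 <= t^-1 by rewrite invr_ge0 ltW.
set d := (1 + t^-1) * (4 / a) * (ham x y)%:R.
have hd : (1 + t^-1) * Q (xrow x - xrow y) <= d.
  rewrite /d -mulrA ler_wpM2l ?addr_ge0 //.
  rewrite mulrAC ler_pdivlMr // mulrC; apply: le_trans (rq_le a0 Au _) _.
  rewrite nrm2E /ham -sum1_card natr_sum mulr_sumr [X in _ <= X]big_mkcond /=.
  apply: ler_sum => j _; rewrite inE !mxE -rmorphB sqn_real /sgn.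
  by case: (x j); case: (y j) => /=; lra.
have d0 : 0 <= d by apply: le_trans hd; rewrite mulr_ge0 ?addr_ge0.
have h := rq_add a0 Au (xrow y + shift i) (xrow x - xrow y) t0.
rewrite (_ : xrow y + shift i + (xrow x - xrow y) = xrow x + shift i) in h; last first.
  by rewrite addrC addrA subrK.
rewrite -/Q in h; rewrite -addrA.
have Qy := Q0 (xrow y + shift i).
apply: (@le_trans _ _ (ln ((1 + Q (xrow y + shift i)) * (1 + (t + d))))).
  apply: Rln_le; first by rewrite ltr_pwDl.
  by move: h hd Qy; set q1 := Q (xrow x + _); set q2 := Q (xrow y + _); nra.
have td : 0 <= t + d by rewrite addr_ge0 // ltW.
have h1 : 0 < 1 + Q (xrow y + shift i) by rewrite ltr_pwDl.
have h2 : 0 < 1 + (t + d) by rewrite ltr_pwDl.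
by rewrite RlnM // lerD2l; apply: Rln1D_le.
Qed.

Lemma ldet_replace X i t : (0 < n)%N -> (0 < #|Sset n s|)%N -> 0 <= pplus n s <= 1 -> 0 < t ->
  `|E1 (@wS n s) i (ldet a S) X - E1 (@wB n s) i (ldet a S) X|
    <= t + (1 + t^-1) * (4 / a) * (2 * Num.sqrt n%:R).
Proof.
move=> n0 S0 p01 t0; have hS := prob_wS S0.
have hB : prob (@wB n s) by apply: (prob_pw _ (prob_bw p01)).
have b0 : 0 <= (1 + t^-1) * (4 / a).
  by rewrite mulr_ge0 // ?addr_ge0 ?invr_ge0 ?divr_ge0 // ltW.
have [iS|iS] := boolP (i \in S); last first.
  have ind : indep (ldet a S) i by move=> Y y; apply: ldet_indep.
  rewrite (E1_indep X hS.2 ind) (E1_indep X hB.2 ind).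
  rewrite subrr normr0; apply: addr_ge0; first exact: ltW.
  by apply: mulr_ge0 => //; rewrite mulr_ge0 ?sqrtr_ge0.
pose phi y := ln (1 + rq (regmx a (rowM X) (S :\ i)) (xrow y + shift i)).
have e w : prob w -> E1 w i (ldet a S) X = ldet a (S :\ i) X + \sum_y w y * phi y.
  move=> hw; rewrite /E1; under eq_bigr => y _ do rewrite ldet_upd // mulrDr.
  by rewrite big_split /= -mulr_suml hw.2 mul1r.
rewrite !e // opprD addrACA subrr add0r; apply: slice_mean_le => // x y.
exact: ln_rq_ham.
Qed.

End Lipschitz.

End RandomRows.

(** * Bad events, their probability, and the estimate outside them *)

Section Assembly.
Arguments Rtrigo_def.exp _ : clear scopes.
Arguments Rpower.ln _ : clear scopes.
Local Notation exp := Rtrigo_def.exp.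
Local Notation ln := Rpower.ln.
Local Notation C := RR[i].

(** A union bound: pointwise, 1 - b - b' is at most the indicator of [E]. *)
Lemma Prob_ge n (s : int) (E : rowsT n -> rowsT n -> bool) (b b' : pred (rowsT n)) :
  prob (@wS n s) -> prob (@wB n s) ->
  (forall X X', ~~ b X -> ~~ b' X' -> E X X') ->
  1 - (Pr (@wS n s) b + Pr (@wB n s) b') <= Prob s E.
Proof.
move=> hS hB hE; have [pS0 pS1] := prob_pw 'I_n hS; have [pB0 pB1] := prob_pw 'I_n hB.
have -> : 1 - (Pr (@wS n s) b + Pr (@wB n s) b')
   = \sum_(X : rowsT n) \sum_(X' : rowsT n)
       pw (@wS n s) X * pw (@wB n s) X' * (1 - (b X)%:R - (b' X')%:R).
  have inner (X : rowsT n) : \sum_(X' : rowsT n) pw (@wS n s) X * pw (@wB n s) X'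
      * (1 - (b X)%:R - (b' X')%:R)
    = pw (@wS n s) X * (1 - (b X)%:R) - pw (@wS n s) X * Pr (@wB n s) b'.
    have -> : pw (@wS n s) X * (1 - (b X)%:R)
        = \sum_(X' : rowsT n) pw (@wS n s) X * (1 - (b X)%:R) * pw (@wB n s) X'.
      by rewrite -mulr_sumr pB1 mulr1.
    by rewrite /Pr /Ex mulr_sumr -sumrB; apply: eq_bigr => X' _; ring.
  under [RHS]eq_bigr => X _ do rewrite inner mulrBr mulr1.
  by rewrite !sumrB -mulr_suml pS1 mul1r opprD addrA.
rewrite /Prob; apply: ler_sum => X _; apply: ler_sum => X' _.
apply: ler_wpM2l; first exact: mulr_ge0.
case: (boolP (b X)) => [_|bX].
  by apply: (@le_trans _ _ 0); rewrite ?ler0n // subrr sub0r oppr_le0 ler0n.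
case: (boolP (b' X')) => [_|bX']; first by rewrite subr0 subrr ler0n.
by rewrite hE // !subr0.
Qed.

Section Events.
Variables (n : nat) (s : int) (z : C) (v : {ffun 'I_n -> bool}).
Variables (a sig th1 th2 : RR) (m m' : nat).
Local Notation f := (ldet z v a (lt_set n m)).
Local Notation B := (row_bound n z).
Implicit Types X : rowsT n.

(** The first event is failure of concentration; excluding the second and third provides the bounds
    [beta] and [del] of [logdet_compare]. *)
Definition bad (mu : RR) X : bool :=
  [|| sig <= `|f X - mu|,
      [exists i : 'I_n, (i < m)%N && near_span z v (lt_set n i) th1 i X]
    | [exists j : 'I_n, (j < m')%N && near_span z v (lt_set n m' :\ j) th2 j X]].

(** McDiarmid's inequality handles the first event. The others are unions over at most [n] rows of
    small ball events for spans of codimension at least [K1] and [K2]. *)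
Lemma bad_prob w Dn q lam c (K1 K2 : nat) :
  0 < a -> (m <= n)%N ->
  prob w -> 0 < q -> q <= pplus n s -> pplus n s <= 1 - q ->
  0 <= Dn -> (forall x, w x <= Dn * wB s x) ->
  ln (1 + B / a) <= c -> 0 <= lam -> lam * c <= 2^-1 ->
  (0 < K1)%N -> (K1 + m <= n)%N -> (0 < K2)%N -> (K2 + m' <= n)%N ->
  th1 = q * K1%:R ^+ 2 / (16 * n%:R) -> th2 = q * K2%:R ^+ 2 / (16 * n%:R) ->
  Pr w (bad (Ex w f)) <= 2 * exp (n%:R * (2 * lam ^+ 2 * c ^+ 2) - lam * sig)
     + (n%:R * (Dn * exp (1 - q * K1%:R / 8)) + n%:R * (Dn * exp (1 - q * K2%:R / 8))).
Proof.
move=> a0 mn hw q0 qp pq Dn0 wD Bc lam0 lamc K10 K1m K20 K2m e1 e2.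
have fc : bdiff f c.
  by move=> i X y y'; apply: le_trans Bc; apply: ldet_bdiff.
have pE0 K : 0 <= Dn * exp (1 - q * K / 8) by rewrite mulr_ge0 // ltW ?Rexp_gt0.
apply: le_trans (Pr_U _ _ hw) _; apply: lerD.
  by have := mcdiarmid sig hw fc lam0 lamc; rewrite card_ord.
have P0 : Pr w (fun _ : rowsT n => false) = 0.
  by rewrite /Pr /Ex big1 // => X _; rewrite mulr0.
apply: le_trans (Pr_U _ _ hw) _; apply: lerD.
  rewrite -[n in n%:R * _]card_ord; apply: Pr_exists => // i.
  have [im|im] := boolP (i < m)%N; last by rewrite /= P0.
  have iS := lt_set_notin i.
  have cS : (K1 + #|lt_set n i| <= n)%N.
    apply: leq_trans K1m; rewrite leq_add2l; apply: leq_trans (card_lt_set_le _ _) _.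
    exact: ltnW.
  by rewrite /= e1; apply: (near_span_prob (s := s)).
rewrite -[n in n%:R * _]card_ord; apply: Pr_exists => // j.
have [jm|jm] := boolP (j < m')%N; last by rewrite /= P0.
rewrite /= e2; apply: (near_span_prob (s := s)) => //; first by rewrite !inE eqxx.
apply: leq_trans K2m; rewrite leq_add2l; apply: leq_trans (card_lt_set_le n m').
by apply: subset_leq_card; apply: subsetDl.
Qed.

(** The factor 2 arises because the distances are square roots of the quantities in
    [logdet_compare]; [hm] matches the range of [Sprod] with [i < m]. *)
Lemma good_logdist mu X :
  0 < a -> 0 < th1 -> 0 < th2 -> th1 <= a + B -> (m' <= m)%N -> (m <= n)%N ->
  (forall i : 'I_n, ((i.+1)%:R <= (n%:R : RR) - (ln n%:R) ^+ 8) = (i < m)%N) ->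
  ~~ bad mu X ->
  [/\ 0 < Sprod z v X, `|f X - mu| < sig
    & 0 <= f X - (n%:R - m%:R) * ln a - 2 * ln (Sprod z v X)
        <= a * n%:R / th2 + (m%:R - m'%:R) * ln ((a + B) / th1)].
Proof.
move=> a0 t1 t2 tB m'm mn hm; rewrite !negb_or => /and3P[h1 /existsPn h2 /existsPn h3].
have [P /choice[M spP]] := choice (fun i : 'I_n => exists_span_proj (rowM z v X) (lt_set n i)).
pose D (i : 'I_n) := nrm2 (row i (rowM z v X) *m P i).
have hbeta (i : 'I_n) : (i < m)%N -> th1 <= D i.
  move=> im; have := h2 i; rewrite im /= => /asboolPn h.
  by rewrite leNgt; apply/negP => hlt; apply: h; exists (P i), (M i); split; [|exact: ltW].
have D0 (i : 'I_n) : (i < m)%N -> 0 < D i by move=> /hbeta; apply: lt_le_trans.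
have eS : Sprod z v X = \prod_(i < n | (i < m)%N) Num.sqrt (D i).
  by rewrite /Sprod; apply: eq_big => [i|i _]; [exact: hm | exact: dist_spanE (spP i)].
have S0 : 0 < Sprod z v X.
  by rewrite eS; apply: prodr_gt0 => i im; rewrite sqrtr_gt0 D0.
have lS : 2 * ln (Sprod z v X) = \sum_(i < n | (i < m)%N) ln (D i).
  rewrite eS Rln_prod => [|i im]; last by rewrite sqrtr_gt0 D0.
  rewrite mulr_sumr; apply: eq_bigr => i im.
  rewrite -(RlnX 2) ?sqrtr_gt0 ?D0 // sqr_sqrtr // ltW ?D0 //.
split=> //; first by rewrite ltNge.
rewrite lS; apply: (logdet_compare (M := M)) => //; first exact: nrm2_row_le.
move=> j Q N jm sp; have := h3 j; rewrite jm /= => /asboolPn h.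
by rewrite leNgt; apply/negP => hlt; apply: h; exists Q, N; split; [|exact: ltW].
Qed.

End Events.

(** Raise L/(k+1) <= exp (L/(k+1)) to the power k+1. *)
Lemma pow_le_exp k (M L : RR) : 0 <= L -> M * k.+1%:R ^+ k.+1 <= L -> M * L ^+ k <= exp L.
Proof.
move=> L0 h; have c0 : 0 < k.+1%:R ^+ k.+1 :> RR by rewrite exprn_gt0 ?ltr0n.
apply: (@le_trans _ _ ((L / k.+1%:R) ^+ k.+1)).
  by rewrite expr_div_n ler_pdivlMr // mulrAC [L ^+ _.+1]exprS ler_wpM2r ?exprn_ge0.
have -> : exp L = exp (L / k.+1%:R) ^+ k.+1.
  by rewrite -RexpX -[(_ / _) *+ _]mulr_natr divfK // pnatr_eq0.
apply: lerXn2r; rewrite ?nnegrE ?(ltW (Rexp_gt0 _)) //.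
  by rewrite divr_ge0 ?ler0n.
by apply: le_trans (Rexp_ge1D _); rewrite lerDr.
Qed.

Lemma eventually_ln_ge (M : RR) :
  exists N, forall n, (N <= n)%N -> (0 < n)%N /\ M <= ln n%:R.
Proof.
exists (Num.truncn (exp M)).+1 => n Nn; have n0 : (0 < n)%N by apply: leq_trans Nn.
split=> //; rewrite -[M]Rln_exp; apply: Rln_le; first exact: Rexp_gt0.
by apply: (le_trans (ltW (truncnS_gt _))); rewrite ler_nat.
Qed.

End Assembly.

(** * Numerical estimates *)

Section Numerics.
Arguments Rtrigo_def.exp _ : clear scopes.
Arguments Rpower.ln _ : clear scopes.
Local Notation exp := Rtrigo_def.exp.
Local Notation ln := Rpower.ln.

(* L stands for ln n, sq for sqrt n, and a = sq L^4 is the regularization parameter. *)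
Lemma numerics_sqrt (q Bz M L sq : RR) : 0 < q -> q <= 1 -> 1 <= L -> 0 <= Bz -> 0 <= sq ->
  (16 / q) ^+ 2 + 128 + Bz <= M -> M * L ^+ 24 <= sq ^+ 2 ->
  [/\ 16 / q * L ^+ 12 <= sq, 128 * L ^+ 11 <= sq ^+ 2 & 128 + Bz <= sq ^+ 2].
Proof.
move=> q0 q1 L1 B0 sq0 hM h.
have L24 : 1 <= L ^+ 24 by rewrite exprn_ege1.
have c0 : 0 <= 16 / q by rewrite divr_ge0 // ltW.
have cc : 0 <= (16 / q) ^+ 2 by apply: sqr_ge0.
have M0 : 0 <= M by lra.
have hM24 : M <= M * L ^+ 24 by rewrite ler_peMr.
split; last by lra.
  rewrite -(ler_pXn2r (n := 2)) ?nnegrE //; last by rewrite mulr_ge0 // exprn_ge0 //; lra.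
  rewrite exprMn -exprM; apply: le_trans h; apply: ler_wpM2r; [lra|lra].
apply: le_trans h; apply: (@le_trans _ _ (128 * L ^+ 24)).
  by rewrite ler_pM2l //; apply: ler_weXn2l.
by apply: ler_wpM2r; lra.
Qed.

(** Each of the four exponential terms, counted with multiplicity, is at most exp (- L^2 - 3), and 8
    <= exp 3. The final half leaves room for the two laws. *)
Lemma tail_bound (q L x nr Dn k1 k2 : RR) : 0 < q -> 1 <= L -> 72 <= q * L ->
  exp L = nr -> 1 <= nr -> Dn <= 4 * nr -> 0 <= Dn ->
  L ^+ 8 <= k1 -> L ^+ 8 <= k2 -> x <= - (4 * L ^+ 2) ->
  2 * exp x + (nr * (Dn * exp (1 - q * k1 / 8)) + nr * (Dn * exp (1 - q * k2 / 8)))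
    <= exp (- L ^+ 2) / 2.
Proof.
move=> q0 L1 qL eL n1 Dn1 Dn0 hk1 hk2 hx.
set e := exp (- L ^+ 2).
have e2 : 2 <= exp 1 by apply: le_trans (Rexp_ge1D _); lra.
have e8 : 8 * exp (- L ^+ 2 - 3) <= e.
  have -> : e = exp (- L ^+ 2 - 3) * (exp 1 * exp 1 * exp 1).
    by rewrite -!RexpD /e; congr exp; ring.
  rewrite mulrC ler_pM2l ?Rexp_gt0 //; nra.
have L2 : 1 <= L ^+ 2 by rewrite exprn_ege1.
have L72 : L ^+ 2 <= L ^+ 7 by apply: ler_weXn2l.
have L71 : L <= L ^+ 7 by rewrite -[X in X <= _]expr1; apply: ler_weXn2l.
have L7 : 1 <= L ^+ 7 by rewrite exprn_ege1.
have h k : L ^+ 8 <= k -> nr * (Dn * exp (1 - q * k / 8)) <= exp (- L ^+ 2 - 3).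
  move=> hk; have hqk : 9 * L ^+ 7 <= q * k / 8.
    have : q * L ^+ 8 <= q * k by rewrite ler_pM2l.
    have : 72 * L ^+ 7 <= q * L ^+ 8 by rewrite (exprS L 7) mulrA ler_wpM2r //; lra.
    lra.
  apply: (@le_trans _ _ (exp L * (exp 1 * exp 1 * exp L * exp (1 - q * k / 8)))).
    rewrite eL ler_wpM2l //; first lra.
    apply: ler_wpM2r; first exact/ltW/Rexp_gt0.
    by apply: le_trans Dn1 _; rewrite ler_wpM2r //; [lra | nra].
  (* The exponents require 2 L + L^2 + 6 <= 9 L^7, which follows since 1, L and L^2 are at most
     L^7. *)
  rewrite -!RexpD; apply: Rexp_le; lra.
have hxx : exp x <= exp (- L ^+ 2 - 3) by apply: Rexp_le; lra.
by have := h k1 hk1; have := h k2 hk2; lra.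
Qed.

(** The first term contributes n/L^2. In the second the logarithm is at most 3 L, its argument being
    at most n^3, and [mm] is at most 2 n/L^3; this contributes 6 n/L^2. *)
Lemma error_bound (q Bz L sq a th1 th2 mm : RR) : 0 < q -> q <= 1 -> 1 <= L -> 0 < sq ->
  exp L = sq ^+ 2 -> 0 <= Bz ->
  16 / q * L ^+ 12 <= sq -> 128 * L ^+ 11 <= sq ^+ 2 -> 128 + Bz <= sq ^+ 2 ->
  a = sq * L ^+ 4 -> (sq ^+ 2)^-1 <= th1 -> q * sq ^+ 2 / (16 * L ^+ 6) <= th2 ->
  0 <= mm -> mm <= sq ^+ 2 / L ^+ 3 + 1 ->
  a * sq ^+ 2 / th2 + mm * ln ((a + Bz * sq ^+ 2) / th1) <= 7 * (sq ^+ 2 / L ^+ 2).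
Proof.
move=> q0 q1 L1 sq0 eL B0 F1 F2 F3 ea hth1 hth2 mm0 hmm.
have L0 : 0 < L by lra.
have LP k : 0 < L ^+ k by rewrite exprn_gt0.
have n0 : 0 < sq ^+ 2 by rewrite exprn_gt0.
have d0 : 0 < q * sq ^+ 2 / (16 * L ^+ 6) by rewrite divr_gt0 // mulr_gt0.
have t2 : 0 < th2 by apply: lt_le_trans hth2.
have t1 : 0 < th1 by apply: lt_le_trans hth1; rewrite invr_gt0.
have q16 : 1 <= 16 / q by rewrite ler_pdivlMr //; lra.
have L12 : L ^+ 12 <= sq.
  by apply: le_trans F1; rewrite ler_peMl // ltW.
have asq : a <= sq ^+ 2.
  rewrite ea expr2 ler_pM2l //; apply: le_trans L12; exact: ler_weXn2l.
have a0 : 0 < a by rewrite ea mulr_gt0.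
have h1 : a * sq ^+ 2 / th2 <= sq ^+ 2 / L ^+ 2.
  rewrite ler_pdivrMr //; apply: (@le_trans _ _ (sq ^+ 2 / L ^+ 2 * (q * sq ^+ 2 / (16 * L ^+ 6)))).
    have -> : a * sq ^+ 2 = sq ^+ 2 / L ^+ 2 * (q * sq / (16 * L ^+ 6)) * (16 / q * L ^+ 12).
      by rewrite ea; field; rewrite !gt_eqF.
    have -> : sq ^+ 2 / L ^+ 2 * (q * sq ^+ 2 / (16 * L ^+ 6))
        = sq ^+ 2 / L ^+ 2 * (q * sq / (16 * L ^+ 6)) * sq.
      by field; rewrite !gt_eqF.
    rewrite ler_pM2l // !mulr_gt0 // invr_gt0 // ?mulr_gt0 //.
  by rewrite ler_pM2l // divr_gt0.
have h2 : ln ((a + Bz * sq ^+ 2) / th1) <= 3 * L.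
  apply: Rln_le_exp.
    by rewrite divr_gt0 // ltr_pwDl // mulr_ge0 // ltW.
  have -> : exp (3 * L) = sq ^+ 2 * sq ^+ 2 * sq ^+ 2.
    by rewrite -eL -!RexpD; congr exp; ring.
  apply: ler_pM; rewrite ?invr_ge0 ?(ltW t1) //.
  - by rewrite addr_ge0 ?mulr_ge0 // ltW.
  - have : (1 + Bz) * sq ^+ 2 <= sq ^+ 2 * sq ^+ 2 by rewrite ler_pM2r //; lra.
    rewrite mulrDl mul1r; lra.
  - by rewrite -[X in _ <= X]invrK lef_pV2 ?posrE ?invr_gt0.
have L3n : 1 <= sq ^+ 2 / L ^+ 3.
  rewrite ler_pdivlMr // mul1r; apply: (le_trans _ F2).
  apply: (@le_trans _ _ (L ^+ 11)); first exact: ler_weXn2l.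
  by have := LP 11%N; lra.
have h3 : mm * ln ((a + Bz * sq ^+ 2) / th1) <= 2 * (sq ^+ 2 / L ^+ 3) * (3 * L).
  apply: (@le_trans _ _ (mm * (3 * L))); first exact: ler_wpM2l.
  by apply: ler_wpM2r; lra.
have e3 : 2 * (sq ^+ 2 / L ^+ 3) * (3 * L) = 6 * (sq ^+ 2 / L ^+ 2).
  by field; rewrite gt_eqF.
by rewrite e3 in h3; lra.
Qed.

(** The common shift [V] cancels. The log-determinants differ by less than 19 sig and the errors by
    at most 7 sig, so 2 |l - l'| < 26 sig. *)
Lemma logs_close (F F' mu mu' V l l' E sig : RR) :
  `|F - mu| < sig -> `|F' - mu'| < sig -> `|mu - mu'| <= 17 * sig ->
  0 <= F - V - 2 * l <= E -> 0 <= F' - V - 2 * l' <= E -> E <= 7 * sig ->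
  `|l - l'| <= 33 * sig.
Proof.
rewrite !ltr_norml !ler_norml => /andP[? ?] /andP[? ?] /andP[? ?] /andP[? ?] /andP[? ?] ?.
by apply/andP; split; lra.
Qed.

End Numerics.

(** * Choice of parameters and conclusion *)

Section Main.
Arguments Rtrigo_def.exp _ : clear scopes.
Arguments Rpower.ln _ : clear scopes.
Local Notation exp := Rtrigo_def.exp.
Local Notation ln := Rpower.ln.

Lemma main_bound (eps : RR) (z : RR[i]) : 0 < eps <= 1 ->
  exists N : nat, forall n (s : int) (v : {ffun 'I_n -> bool}),
    (N <= n)%N -> `|(s%:~R : RR)| <= (1 - eps) * n%:R -> (0 < #|Sset n s|)%N ->
    1 - exp (- (ln n%:R) ^+ 2) <= Prob s (good_event z v 33%R).
Proof.
move=> /andP[eps0 eps1].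
(* Since |s| <= (1 - eps) n, both Bernoulli probabilities are at least eps/2. *)
pose q := eps / 2; pose Bz := 8 + 2 * sqn z.
have q0 : 0 < q by rewrite /q; lra.
have q1 : q <= 1 by rewrite /q; lra.
have Bz8 : 8 <= Bz by have := sqn_ge0 z; rewrite /Bz; lra.
pose M := (16 / q) ^+ 2 + 128 + Bz.
have M0 : 0 <= M by have := sqr_ge0 (16 / q); rewrite /M; lra.
(* The threshold on L that [pow_le_exp] with k = 24 requires for M L^24 <= n; it stays behind an
   equation so that the numeral is not expanded. *)
have [W W0 WE] : exists2 W : RR, 0 <= W & W = M * 25%:R ^+ 25.
  by eexists; last reflexivity; rewrite mulr_ge0 // exprn_ge0 // ler0n.
have q72 : 0 <= 72 / q by rewrite divr_ge0 // ltW.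
have [N hN] := eventually_ln_ge (72 / q + 1 + W)%R.
exists N => n s v Nn hs S0; have [n0 hL] := hN n Nn.
set L := ln n%:R in hL *; have L1 : 1 <= L by lra.
have L0 : 0 < L by lra.
have LP k : 0 < L ^+ k by rewrite exprn_gt0.
have n0r : 0 < n%:R :> RR by rewrite ltr0n.
have n1r : 1 <= n%:R :> RR by rewrite ler1n.
have eL : exp L = n%:R by rewrite /L Rexp_ln.
have qL : 72 <= q * L by rewrite mulrC -ler_pdivrMr //; lra.
pose sq := Num.sqrt (n%:R : RR).
have sq0 : 0 < sq by rewrite sqrtr_gt0.
have sqE : sq ^+ 2 = n%:R by rewrite sqr_sqrtr // ltW.
have hM : M * L ^+ 24 <= sq ^+ 2.
  by rewrite sqE -eL; apply: pow_le_exp; [exact: ltW | rewrite -WE; lra].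
have [F1 F2 F3] : [/\ 16 / q * L ^+ 12 <= sq, 128 * L ^+ 11 <= sq ^+ 2 & 128 + Bz <= sq ^+ 2].
  have Bz0 : 0 <= Bz by lra.
  exact: (numerics_sqrt q0 q1 L1 Bz0 (ltW sq0) (lexx M) hM).
have L8n : 128 * L ^+ 8 <= n%:R.
  by rewrite -sqE; apply: le_trans F2; rewrite ler_pM2l //; apply: ler_weXn2l.
have [qp pq] : q <= pplus n s /\ pplus n s <= 1 - q.
  rewrite pplusE; move: hs; rewrite ler_norml => /andP[h1 h2].
  have -> : s%:~R / (2 * n%:R) = (s%:~R / n%:R) / 2 :> RR by field; rewrite gt_eqF.
  have : s%:~R / n%:R <= 1 - eps by rewrite ler_pdivrMr.
  have : - (1 - eps) <= s%:~R / n%:R by rewrite ler_pdivlMr // mulNr.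
  by rewrite /q; split; lra.
have p01 : 0 < pplus n s < 1 by apply/andP; split; clear -q0 qp pq; lra.
pose a := sq * L ^+ 4.
have a0 : 0 < a by rewrite mulr_gt0.
have sq1 : 1 <= sq by rewrite -[X in X <= _]sqrtr1 ler_wsqrtr.
have a1 : 1 <= a by rewrite mulr_ege1 // exprn_ege1.
have L8p : 0 <= n%:R - L ^+ 8 by have := LP 8%N; clear -L8n; lra.
have L3n : 0 <= n%:R - n%:R / L ^+ 3.
  by rewrite subr_ge0 ler_pdivrMr // ler_peMr ?exprn_ege1 // ltW.
(* Integer parts, so that i + 1 <= n - L^8 holds exactly when i < m. The codimensions [K1] and [K2]
   are then at least L^8 and n/L^3. *)
pose m := Num.truncn (n%:R - L ^+ 8); pose m' := Num.truncn (n%:R - n%:R / L ^+ 3).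
have /andP[m_le m_gt] := truncn_itv L8p; rewrite -/m in m_le m_gt.
have /andP[m'_le m'_gt] := truncn_itv L3n; rewrite -/m' in m'_le m'_gt.
have mn : (m <= n)%N by rewrite -(ler_nat RR); have := LP 8%N; clear -m_le; lra.
have L83 : L ^+ 8 <= n%:R / L ^+ 3.
  by rewrite ler_pdivlMr // -exprD -sqE; have := LP 11%N; clear -F2; lra.
have m'm : (m' <= m)%N by rewrite /m' /m le_truncn //; clear -L83; lra.
have m'n := leq_trans m'm mn.
pose K1 := (n - m)%N; pose K2 := (n - m')%N.
have K1E : K1%:R = n%:R - m%:R :> RR by rewrite /K1 natrB.
have K2E : K2%:R = n%:R - m'%:R :> RR by rewrite /K2 natrB.
have K1L : L ^+ 8 <= K1%:R by (clear -K1E m_le; lra).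
have K2L : n%:R / L ^+ 3 <= K2%:R by (clear -K2E m'_le; lra).
have K2L8 : L ^+ 8 <= K2%:R by (clear -K2L L83; lra).
have K10 : (0 < K1)%N by rewrite -(ltr0n RR); apply: lt_le_trans K1L.
have K20 : (0 < K2)%N by rewrite -(ltr0n RR); apply: lt_le_trans K2L8.
have K1n : K1%:R <= n%:R :> RR by rewrite ler_nat leq_subr.
pose th1 := q * K1%:R ^+ 2 / (16 * n%:R); pose th2 := q * K2%:R ^+ 2 / (16 * n%:R).
have th1_ge : (sq ^+ 2)^-1 <= th1.
  have -> : th1 = q * K1%:R ^+ 2 / 16 * n%:R^-1 by rewrite /th1; field; rewrite gt_eqF.
  rewrite sqE -[X in X <= _]mul1r ler_pM2r ?invr_gt0 //.
  rewrite ler_pdivlMr // mul1r; apply: (@le_trans _ _ (q * L)); first by (clear -qL; lra).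
  rewrite ler_pM2l //; apply: le_trans (_ : L ^+ 16 <= _).
    by rewrite -[X in X <= _]expr1; apply: ler_weXn2l.
  rewrite -[16%N]/(8 * 2)%N exprM; apply: lerXn2r; rewrite ?nnegrE // ?ler0n //.
  exact: ltW.
have th2_ge : q * sq ^+ 2 / (16 * L ^+ 6) <= th2.
  rewrite sqE /th2; have -> : q * n%:R / (16 * L ^+ 6) = q * (n%:R / L ^+ 3) ^+ 2 / (16 * n%:R).
    by field; rewrite !gt_eqF.
  rewrite ler_wpM2r ?invr_ge0 ?mulr_ge0 ?ler0n // ler_pM2l //.
  by apply: lerXn2r; rewrite ?nnegrE ?ler0n // divr_ge0 // ltW.
have t10 : 0 < th1 by apply: lt_le_trans th1_ge; rewrite invr_gt0 exprn_gt0.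
have t20 : 0 < th2 by apply: lt_le_trans th2_ge; rewrite divr_gt0 // mulr_gt0 // exprn_gt0.
have eB : row_bound n z = Bz * n%:R by [].
have th1B : th1 <= a + row_bound n z.
  have : th1 <= n%:R.
    rewrite /th1 ler_pdivrMr ?mulr_gt0 //.
    have h1 : K1%:R ^+ 2 <= n%:R * n%:R :> RR by rewrite expr2; apply: ler_pM; rewrite ?ler0n.
    have h2 : q * K1%:R ^+ 2 <= 1 * (n%:R * n%:R) by apply: ler_pM; rewrite ?exprn_ge0 ?ler0n ?(ltW q0).
    have h3 : 0 <= n%:R * n%:R :> RR by rewrite mulr_ge0.
    clear -h2 h3; lra.
  have : 8 * n%:R <= Bz * n%:R by rewrite ler_wpM2r // ltW.
  by rewrite eB; clear -a0 n0r; lra.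
pose sig := n%:R / L ^+ 2; pose lam := (16 * L ^+ 4)^-1.
have lam0 : 0 <= lam by rewrite invr_ge0 mulr_ge0 // ltW.
have lamc : lam * (2 * L) <= 2^-1.
  rewrite /lam mulrC ler_pdivrMr ?mulr_gt0 //.
  have : L <= L ^+ 4 by rewrite -[X in X <= _]expr1; apply: ler_weXn2l.
  by (clear -L1; lra).
have cB : ln (1 + row_bound n z / a) <= 2 * L.
  have B0 : 0 <= row_bound n z by rewrite eB mulr_ge0 ?ler0n //; clear -Bz8; lra.
  apply: Rln_le_exp; first by rewrite ltr_pwDl // divr_ge0 // ltW.
  have -> : exp (2 * L) = n%:R * n%:R by rewrite -eL -RexpD; congr exp; ring.
  have h1 : row_bound n z / a <= Bz * n%:R by rewrite ler_pdivrMr // -eB ler_peMr.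
  have h2 : (128 + Bz) * n%:R <= n%:R * n%:R by rewrite ler_wpM2r ?(ltW n0r) // -sqE.
  by rewrite mulrDl in h2; clear -h1 h2 n1r; lra.
have hx : n%:R * (2 * lam ^+ 2 * (2 * L) ^+ 2) - lam * sig <= - (4 * L ^+ 2).
  have -> : n%:R * (2 * lam ^+ 2 * (2 * L) ^+ 2) - lam * sig = - (n%:R / (32 * L ^+ 6)).
    by rewrite /lam /sig; field; rewrite gt_eqF.
  rewrite lerN2 ler_pdivlMr ?mulr_gt0 //.
  have -> : 4 * L ^+ 2 * (32 * L ^+ 6) = 128 * L ^+ 8 by ring.
  by [].
pose f := ldet z v a (lt_set n m).
have hS := prob_wS S0.
have p01' : 0 <= pplus n s <= 1 by case/andP: p01 => /ltW-> /ltW->.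
have hB : prob (@wB n s) by apply: (prob_pw _ (prob_bw p01')).
pose Dn : RR := (2 * n.+1%:R)%R.
have Dn1 : 1 <= Dn by rewrite /Dn -natr1; clear -n1r; lra.
have Dn0 : 0 <= Dn by (clear -Dn1; lra).
have Dn4 : Dn <= 4 * n%:R by rewrite /Dn -natr1; clear -n1r; lra.
have wSD (x : {ffun 'I_n -> bool}) : wS s x <= Dn * wB s x by exact: wS_le_wB.
have wBD (x : {ffun 'I_n -> bool}) : wB s x <= Dn * wB s x by rewrite ler_peMl // hB.1.
have K1m : (K1 + m <= n)%N by rewrite /K1 subnK.
have K2m : (K2 + m' <= n)%N by rewrite /K2 subnK.
have tb := @tail_bound q L _ n%:R Dn K1%:R K2%:R q0 L1 qL eL n1r Dn4 Dn0 K1L K2L8 hx.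
have bS := @bad_prob n s z v a sig th1 th2 m m' _ Dn q lam (2 * L)%R K1 K2 a0 mn hS q0 qp pq
  Dn0 wSD cB lam0 lamc K10 K1m K20 K2m erefl erefl.
have bB := @bad_prob n s z v a sig th1 th2 m m' _ Dn q lam (2 * L)%R K1 K2 a0 mn hB q0 qp pq
  Dn0 wBD cB lam0 lamc K10 K1m K20 K2m erefl erefl.
set muS := Ex _ _ in bS; set muB := Ex _ _ in bB.
have hmu : `|muS - muB| <= 17 * sig.
  (* This [t] makes the cost per row at most L^-2 + 2 L^2 (8/L^4) = 17/L^2, since sq/a = L^-4. *)
  pose t := (L ^+ 2)^-1.
  have t0 : 0 < t by rewrite invr_gt0.
  pose eta := t + (1 + t^-1) * (4 / a) * (2 * sq).
  have hl i X : `|E1 (@wS n s) i f X - E1 (@wB n s) i f X| <= eta by apply: ldet_replace.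
  have heta : eta <= 17 / L ^+ 2.
    have -> : eta = (L ^+ 2)^-1 + (1 + L ^+ 2) * (8 / L ^+ 4).
      by rewrite /eta /t /a -/sq invrK; field; rewrite !gt_eqF.
    have -> : 17 / L ^+ 2 = (L ^+ 2)^-1 + (2 * L ^+ 2) * (8 / L ^+ 4).
      by field; rewrite gt_eqF.
    rewrite lerD2l ler_wpM2r ?divr_ge0 ?(ltW (LP _)) //.
    have : 1 <= L ^+ 2 by rewrite exprn_ege1.
    clear -n0r; lra.
  have eta0 : 0 <= eta.
    have := hl (Ordinal n0) [ffun=> v]; apply: le_trans; exact: normr_ge0.
  have := lindeberg hS hB eta0 hl; rewrite card_ord -/muS -/muB => h.
  apply: le_trans h _; rewrite /sig mulrCA.
  by rewrite ler_pM2l.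
have hmL : forall i : 'I_n, ((i.+1)%:R <= (n%:R : RR) - L ^+ 8) = (i < m)%N.
  by move=> i; rewrite -truncn_ge_nat.
have err : a * n%:R / th2 + (m%:R - m'%:R) * ln ((a + row_bound n z) / th1) <= 7 * sig.
  rewrite eB /sig -sqE; apply: (@error_bound q Bz L) => //; rewrite ?sqE //.
  - clear -Bz8; lra.
  - by rewrite subr_ge0 ler_nat.
  - by have := LP 8%N; clear -m_le m'_gt; lra.
(* Each law contributes a failure probability of at most half of exp (- L^2). *)
apply: le_trans (@Prob_ge n s _ (bad z v a sig th1 th2 m m' muS)
  (bad z v a sig th1 th2 m m' muB) hS hB _); first by (clear -tb bS bB; lra).
move=> X X' gX gX'.
have [SX fX dX] := good_logdist a0 t10 t20 th1B m'm mn hmL gX.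
have [SX' fX' dX'] := good_logdist a0 t10 t20 th1B m'm mn hmL gX'.
rewrite /good_event SX SX' /= -/L.
rewrite ler_pdivrMr //; have -> : 33 / L ^+ 2 * n%:R = 33 * sig by rewrite /sig; ring.
exact: logs_close fX fX' hmu dX dX' err.
Qed.

End Main.

Theorem theorem2p1 (eps : RR) (z : RR[i]) :
  0 < eps <= 1 ->
  exists (C : RR) (delta : nat -> RR) (N : nat),
    0 < C /\
    (forall eta : RR, 0 < eta -> exists M : nat, forall n, (M <= n)%N -> `|delta n| <= eta) /\
    forall (n : nat) (s : int) (v : {ffun 'I_n -> bool}),
      (N <= n)%N ->
      `|(s%:~R : RR)| <= (1 - eps) * n%:R ->
      (0 < #|Sset n s|)%N ->
      1 - Rtrigo_def.exp (- Rpower (ln (n%:R)) (2 - delta n)) <= Prob s (good_event z v C).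
Proof.
move=> heps; have [N hN] := main_bound z heps.
have [N1 hN1] := eventually_ln_ge 1%R.
(* The exponent 2 is reached exactly, so [delta] is 0. The bound [N1] makes ln n positive, so that
   its [Rpower] with exponent 2 is the ordinary square. *)
exists 33%R, (fun _ => 0%R), (maxn N N1); split; first by lra.
split; first by move=> eta eta0; exists 0%N => n _; rewrite normr0 ltW.
move=> n s v; rewrite geq_max => /andP[Nn N1n] hs S0.
have [_ L1] := hN1 n N1n; set L := ln _ in L1 *.
have -> : Rpower L (Rminus (IZR 2) 0%R) = (L ^+ 2)%R.
  have -> : Rminus (IZR 2) 0%R = (2%:R : RR)%R by rewrite RminusE subr0.
  rewrite /Rpower RmultE -RlnX; last by apply: lt_le_trans L1.
  by rewrite Rexp_ln // exprn_gt0 //; apply: lt_le_trans L1.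
exact: hN.
Qed.
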